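(* Let $\alpha\in(0,1)$. Suppose $T$ and $Q$ are uniformly Hadamard differentiable in $J$ with Hadamard derivatives $\mathrm dT(J)$ and $\mathrm dQ(J)$, respectively, and assume $J$ is uniformly continuous. If the distribution function of $\sup_{z\in\overline{\mathbb R}^u}|U(z)|$ is strictly increasing on the non-negative half-line and $T(F,G)-Q(F,G)$ does not vanish everywhere on $\overline{\mathbb R}^u$, then $\lim_{\min N\to\infty}P(\mathrm{KS}_N\ge c_{N;1-\alpha})=1$. If the distribution function of $\int U^2(z)\,T(J)(\mathrm dz)$ is strictly increasing on the non-negative half-line and $T(F,G)-Q(F,G)$ does not vanish $T(J)$-almost everywhere, then $\lim_{\min N\to\infty}P(\mathrm{CvM}_N\ge d_{N;1-\alpha})=1$.
   Context: Conventions: $\overline{\mathbb R}^l=[-\infty,\infty]^l$ with its compact product topology; $\le$ and $\min$ on $\overline{\mathbb R}^l$ are componentwise; $\mathrm I(\cdot)$ is the indicator. $\mathcal D(\overline{\mathbb R}^l)$ is the set of all distribution functions defined on $\overline{\mathbb R}^l$; $\ell^\infty(S)$ is the space of bounded real functions on $S$ with the supremum norm; $\int h(x)K(\mathrm dx)$ is integration with respect to the probability measure with distribution function $K$. Setting: $m,s,u\in\mathbb N$. $X_1,X_2,\dots$ are independent $\mathbb R^m$-valued random vectors with distribution functions $F_i$, $V_1,V_2,\dots$ are independent $\mathbb R^s$-valued random vectors with distribution functions $G_i$ (neither sequence need be identically distributed), and the two sequences are independent of each other. $F\in\mathcal D(\overline{\mathbb R}^m)$, $G\in\mathcal D(\overline{\mathbb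 R}^s)$ are uniformly continuous with $F_i\to F$ and $G_i\to G$ uniformly. $N=\{n,r\}$ denotes the sample sizes; limits as $\min N\to\infty$ are taken along sample sizes with $n/r\to\eta\in(0,\infty)$. Real weights satisfy $\alpha_{i,n}\ge0$, $\sum_{i=1}^n\alpha_{i,n}=1$, $\sqrt n\max_i\alpha_{i,n}\to0$, $n\sum_{i=1}^n\alpha_{i,n}^2\to\kappa\in[1,\infty)$, and $\beta_{i,r}\ge0$, $\sum_{i=1}^r\beta_{i,r}=1$, $\sqrt r\max_i\beta_{i,r}\to0$, $r\sum_{i=1}^r\beta_{i,r}^2\to\tau\in[1,\infty)$. Put $\hat{\mathbb F}_n(x)=\sum_{i=1}^n\alpha_{i,n}\mathrm I(X_i\le x)$, $\hat{\mathbb G}_r(v)=\sum_{i=1}^r\beta_{i,r}\mathrm I(V_i\le v)$. Functionals: $T,Q:\mathcal D(\overline{\mathbb R}^m)\times\mathcal D(\overline{\mathbb R}^s)\to\mathcal D(\overline{\mathbb R}^u)$ and $j:\mathcal D(\overline{\mathbb R}^m)\times\mathcal D(\overline{\mathbb R}^s)\to\mathcal D(\overline{\mathbb R}^m)\times\mathcal D(\overline{\mathbb R}^s)$ are continuous for the supremum metrics, $T\circ j=Q\circ j$, and $j(K)=K$ whenever $T(K)=Q(K)$. Put $\hat{\mathbb J}_N=j(\hat{\mathbb F}_n,\hat{\mathbb G}_r)=(\hat{\mathbb J}_{N,m},\hat{\mathbb J}_{N,s})$ and $J=j(F,G)=(J_m,J_s)$. It is assumed that $T(\hat{\mathbb F}_n,\hat{\mathbb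 G}_r)$, $Q(\hat{\mathbb F}_n,\hat{\mathbb G}_r)$, $T(\hat{\mathbb J}_N)$ are step functions with countably many vertices (to guarantee measurability). Statistics: $U_N(z)=\sqrt[4]{nr}\,\big(T(\hat{\mathbb F}_n,\hat{\mathbb G}_r)(z)-Q(\hat{\mathbb F}_n,\hat{\mathbb G}_r)(z)\big)$, $\mathrm{KS}_N=\sup_{z\in\overline{\mathbb R}^u}|U_N(z)|$, $\mathrm{CvM}_N=\int U_N^2(z)\,T(\hat{\mathbb J}_N)(\mathrm dz)$. Critical values: for $H=(H_m,H_s)\in\mathcal D(\overline{\mathbb R}^m)\times\mathcal D(\overline{\mathbb R}^s)$ let $c_N(H)$ (resp. $d_N(H)$) be the $(1-\alpha)$-quantile of the distribution that $\mathrm{KS}_N$ (resp. $\mathrm{CvM}_N$) has when $X_1,\dots,X_n$ are i.i.d. with distribution function $H_m$ and, independently, $V_1,\dots,V_r$ are i.i.d. with distribution function $H_s$. Then $c_{N;1-\alpha}=c_N(\hat{\mathbb J}_N)$, $d_{N;1-\alpha}=d_N(\hat{\mathbb J}_N)$. Uniform Hadamard differentiability of $T$ in $K\in\mathcal D(\overline{\mathbb R}^m)\times\mathcal D(\overline{\mathbb R}^s)$: there is a continuous linear map $\mathrm dT(K):\ell^\infty(\overline{\mathbb R}^m)\times\ell^\infty(\overline{\mathbb R}^s)\to\ell^\infty(\overline{\mathbb R}^u)$ (the Hadamard derivative) such that $t_n^{-1}(T(K_n+t_nL_n)-T(K_n))\to\mathrm dT(K)(L)$ uniformly on $\overline{\mathbb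 R}^u$ for all $K_n\in\mathcal D(\overline{\mathbb R}^m)\times\mathcal D(\overline{\mathbb R}^s)$ with $K_n\to K$ uniformly, all $L_n,L\in\ell^\infty(\overline{\mathbb R}^m)\times\ell^\infty(\overline{\mathbb R}^s)$ with $L_n\to L$ uniformly, and all $t_n\in(0,\infty)$ with $t_n\to0$, such that $K_n+t_nL_n\in\mathcal D(\overline{\mathbb R}^m)\times\mathcal D(\overline{\mathbb R}^s)$ for all $n$. Limit process: on $\overline{\mathbb R}^l$ let $\rho(x,y)=\int|\mathrm I(w\le x)-\mathrm I(w\le y)|\,\Phi_l(\mathrm dw)$, $\Phi_l$ the distribution function of the $l$-dimensional standard normal distribution. $M_m$ and $M_s$ are independent centered Gaussian processes on $\overline{\mathbb R}^m$ and $\overline{\mathbb R}^s$ with a.s. uniformly $\rho$-continuous sample paths and covariance functions $\kappa\eta\big(J_m(\min(x,y))-J_m(x)J_m(y)\big)$ and $\tau\eta\big(J_s(\min(v,w))-J_s(v)J_s(w)\big)$ respectively; $M=(M_m,M_s)$ and $U(z)=\mathrm dT(J)(M)(z)-\mathrm dQ(J)(M)(z)$, $z\in\overline{\mathbb R}^u$. *)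

(* Defs.v *)
From HB Require Import structures.
From mathcomp Require Import all_boot all_order all_algebra.
From mathcomp Require Import all_classical all_reals all_analysis.

Set Implicit Arguments.
Unset Strict Implicit.
Unset Printing Implicit Defensive.

Import Order.TTheory GRing.Theory Num.Theory.
Import numFieldNormedType.Exports.

Local Open Scope classical_set_scope.
Local Open Scope ring_scope.

(* The points of [-oo, +oo]^l, with the topology and uniformity that matrices
   inherit from \bar R: the product topology, and its unique compatible
   uniformity since the space is compact. *)
Notation xspace R l := 'rV[\bar R]_l.

(* functions on [-oo, +oo]^l; pairs of them when there are two samples *)
Notation xfun R l := (xspace R l -> R).
Notation xfun2 R m s := (xfun R m * xfun R s)%type.

(* uniform convergence is convergence for these types *)
Notation uxfun R l := {uniform xspace R l -> R}.
Notation uxfun2 R m s := (uxfun R m * uxfun R s)%type.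

Notation borel T := (g_sigma_algebraType (@open T)).

Section points.
Context {R : realType} {l : nat}.
Implicit Types x y : xspace R l.

Definition le_pt x y := [forall i, (x ord0 i <= y ord0 i)%E].

Definition min_pt x y : xspace R l := \row_i Order.min (x ord0 i) (y ord0 i).

Definition ext_pt (x : 'rV[R]_l) : xspace R l := \row_i (x ord0 i)%:E.

End points.

(* Inner probability.  It coincides with P on every event (lemma below) and on
   every set of the P-completion; unlike P A it is meaningful for sets that are
   not known to be measurable, such as events about suprema over uncountable
   index sets. *)
Definition inner_pr {d : measure_display} {Omega : measurableType d}
    {R : realType} (P : probability Omega R) (A : set Omega) : \bar R :=
  ereal_sup [set P B | B in [set B | measurable B /\ B `<=` A]].

Lemma inner_prE {d : measure_display} {Omega : measurableType d}
    {R : realType} (P : probability Omega R) (A : set Omega) :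
  measurable A -> inner_pr P A = P A.
Proof.
move=> mA; apply/eqP; rewrite eq_le; apply/andP; split.
  apply: ge_ereal_sup => _ [B [mB BA] <-].
  by rewrite le_measure ?inE.
apply: ereal_sup_ubound; exists A => //; split=> //; exact: subset_refl.
Qed.

(* the p-quantile of the law with distribution function G *)
Definition quantile {R : realType} (p : R) (G : R -> \bar R) : \bar R :=
  ereal_inf [set t%:E | t in [set t : R | (p%:E <= G t)%E]].

Definition sup_abs {R : realType} {l : nat} (f : xfun R l) : \bar R :=
  ereal_sup [set (`|f z|)%:E | z in [set: xspace R l]].

Section distribution_functions.
Context {R : realType}.

Definition is_df_of {l} (K : xfun R l)
    (mu : probability (borel (xspace R l)) R) :=
  forall x, mu [set w | le_pt w x] = (K x)%:E.

Definition distfun l : set (xfun R l) := [set K | exists mu, is_df_of K mu].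

Definition distfun2 m s : set (xfun2 R m s) :=
  [set K | distfun K.1 /\ distfun K.2].

(* The probability measure with distribution function K.  It is unique for K in
   distfun; the Dirac measure is a dummy value outside distfun. *)
Definition df_prob {l} (K : xfun R l) : probability (borel (xspace R l)) R :=
  xget (\d_(const_mx -oo%E : borel (xspace R l))
          : probability (borel (xspace R l)) R) [set mu | is_df_of K mu].

(* a discrete distribution function: countably many vertices z k, at which it
   jumps by p k *)
Definition countable_step {l} (K : xfun R l) :=
  exists (p : nat -> R) (z : nat -> xspace R l), (forall k, 0 <= p k) /\
    forall x, series (fun k => p k * (le_pt (z k) x)%:R) @ \oo --> K x.

(* distribution function of the standard normal law on R^l, extended to
   [-oo, +oo]^l *)
Definition std_normal_df l : xfun R l := fun x =>
  \prod_(i < l)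
    fine (normal_prob 0 1 [set t : R | (t%:E <= x ord0 i)%E]).

Definition rho {l} (x y : xspace R l) : \bar R :=
  \int[df_prob (@std_normal_df l)]_w
    (`| (le_pt w x)%:R - (le_pt w y)%:R | : R)%:E.

Definition rho_unif_continuous {l} (f : xfun R l) :=
  forall e : R, 0 < e -> exists2 de : R, 0 < de &
    forall x y, (rho x y < de%:E)%E -> `|f x - f y| < e.

End distribution_functions.

Arguments distfun {R} l.
Arguments distfun2 {R} m s.

Section functionals.
Context {R : realType} {m s u : nat}.

Definition bounded2 : set (xfun2 R m s) :=
  [set L | bounded_fun L.1 /\ bounded_fun L.2].

(* dT is a continuous linear map between the spaces of bounded functions with
   the supremum norm; its values at unbounded functions are irrelevant *)
Definition continuous_linear (dT : xfun2 R m s -> xfun R u) :=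
  [/\ forall L, bounded2 L -> bounded_fun (dT L),
      forall (a : R) L L', bounded2 L -> bounded2 L' ->
        dT ((fun x => a * L.1 x + L'.1 x), (fun v => a * L.2 v + L'.2 v)) =
        (fun z => a * dT L z + dT L' z) &
      {within (bounded2 : set (uxfun2 R m s)),
        continuous (dT : uxfun2 R m s -> uxfun R u)}].

Definition perturb (K : xfun2 R m s) (t : R) (L : xfun2 R m s) : xfun2 R m s :=
  ((fun x => K.1 x + t * L.1 x), (fun v => K.2 v + t * L.2 v)).

(* T is uniformly Hadamard differentiable in K with derivative dT *)
Definition unif_hadamard_diff (T : xfun2 R m s -> xfun R u) (K : xfun2 R m s)
    (dT : xfun2 R m s -> xfun R u) :=
  continuous_linear dT /\
  forall (K_ L_ : nat -> xfun2 R m s) (L : xfun2 R m s) (t : nat -> R),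
    (forall n, distfun2 m s (K_ n)) ->
    {uniform, (fun n => (K_ n).1) @ \oo --> K.1} ->
    {uniform, (fun n => (K_ n).2) @ \oo --> K.2} ->
    (forall n, bounded2 (L_ n)) -> bounded2 L ->
    {uniform, (fun n => (L_ n).1) @ \oo --> L.1} ->
    {uniform, (fun n => (L_ n).2) @ \oo --> L.2} ->
    (forall n, 0 < t n) -> t @ \oo --> 0 ->
    (forall n, distfun2 m s (perturb (K_ n) (t n) (L_ n))) ->
    {uniform, (fun n z =>
      (t n)^-1 * (T (perturb (K_ n) (t n) (L_ n)) z - T (K_ n) z)) @ \oo
      --> dT L}.

End functionals.

Section independence.
Context {d : measure_display} {Omega : measurableType d} {R : realType}.
Variable P : probability Omega R.

(* mutual independence of a sequence; finite subfamilies are obtained by taking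
   A i = setT *)
Definition independent_seq {d'} {E : measurableType d'} 
    (X : nat -> {RV P >-> E}) :=
  forall (n : nat) (A : nat -> set E), (forall i, measurable (A i)) ->
    P (\bigcap_(i in `I_n) (X i @^-1` A i)) =
    (\prod_(i < n) fine (P (X i @^-1` A i)))%:E.

Definition gen_sigma {I : Type} {d'} {E : measurableType d'}
    (X : I -> {RV P >-> E}) : set (set Omega) :=
  <<s \bigcup_i preimage_set_system setT (X i) measurable >>.

Definition independent_families {I J : Type} {d1 d2}
    {E1 : measurableType d1} {E2 : measurableType d2}
    (X : I -> {RV P >-> E1}) (Y : J -> {RV P >-> E2}) :=
  forall A B, gen_sigma X A -> gen_sigma Y B ->
    P (A `&` B) = (P A * P B)%E.

(* univariate normal law, possibly degenerate; note that normal_prob m 0 is not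
   a Dirac measure *)
Definition normal_rv (Y : Omega -> R) :=
  exists mu sigma : R,
    (0 < sigma /\
     forall A, measurable A -> P (Y @^-1` A) = normal_prob mu sigma A) \/
    {ae P, forall w, Y w = mu}.

(* centered Gaussian process with covariance function c *)
Definition centered_gaussian {S : Type} (M : S -> {RV P >-> R})
    (c : S -> S -> R) :=
  [/\ forall (n : nat) (x : 'I_n -> S) (a : 'I_n -> R),
        normal_rv (fun w => \sum_(i < n) a i * M (x i) w),
      forall x, ('E_P[M x] = 0)%E &
      forall x y, covariance P (M x) (M y) = (c x y)%:E].

Definition df_of_rv {l} (X : {RV P >-> borel 'rV[R]_l}) : xfun R l :=
  fun x => fine (P [set w | le_pt (ext_pt (X w)) x]).

(* the first n observations of a sequence of random vectors *)
Definition obs {l} (X : nat -> {RV P >-> borel 'rV[R]_l}) (n : nat)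
    (w : Omega) : 'I_n -> xspace R l :=
  fun i => ext_pt (X i w).

End independence.

Arguments obs {d Omega R P l} X n w _.

Section iid.
Context {d : measure_display} {E : measurableType d} {R : realType}.

Definition tcons n (p : E * n.-tuple E) : n.+1.-tuple E :=
  [tuple of p.1 :: p.2].

Lemma measurable_tcons n : measurable_fun setT (@tcons n).
Proof. exact: measurable_cons. Qed.

HB.instance Definition _ n :=
  isMeasurableFun.Build _ _ _ _ (@tcons n) (@measurable_tcons n).

(* law of n i.i.d. random elements with law P *)
Fixpoint iid_prob (P : probability E R) (n : nat) :
    probability (n.-tuple E) R :=
  if n is n'.+1 then
    distribution (P \x iid_prob P n')%E (@tcons n')
  else \d_([tuple] : 0.-tuple E).

End iid.

Section statistics.
Context {R : realType} {m s u : nat}.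
Variables (T Q : xfun2 R m s -> xfun R u) (j : xfun2 R m s -> xfun2 R m s).
(* a n i is the weight of observation i (counted from 0) in a sample of size n *)
Variables (a b : nat -> nat -> R).

Definition wecdf {l} (w : nat -> nat -> R) (n : nat) (x : 'I_n -> xspace R l) :
    xfun R l :=
  fun t => \sum_(i < n) w n i * (le_pt (x i) t)%:R.

Section fixed_sizes.
Context {n r : nat}.
Implicit Types (x : 'I_n -> xspace R m) (v : 'I_r -> xspace R s).

Definition emp x v : xfun2 R m s := (wecdf a x, wecdf b v).

Definition U_stat x v : xfun R u := fun z =>
  (n%:R * r%:R) `^ (4%:R^-1) * (T (emp x v) z - Q (emp x v) z).

Definition KS_stat x v : \bar R := sup_abs (U_stat x v).

Definition CvM_stat x v : \bar R :=
  \int[df_prob (T (j (emp x v)))]_z ((U_stat x v z) ^+ 2)%:E.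

(* law of the two samples when they are i.i.d. with distribution functions
   H.1 and H.2 *)
Definition sample_prob (H : xfun2 R m s) :=
  (iid_prob (df_prob H.1) n \x iid_prob (df_prob H.2) r)%E.

Definition crit_val (stat : ('I_n -> xspace R m) -> ('I_r -> xspace R s) -> \bar R)
    (p : R) (H : xfun2 R m s) : \bar R :=
  quantile p (fun t => inner_pr (sample_prob H)
    [set xv | (stat (tnth xv.1) (tnth xv.2) <= t%:E)%E]).

End fixed_sizes.
End statistics.

(* Main.v *)
Require Import Defs.
From HB Require Import structures.
From mathcomp Require Import all_boot all_order all_algebra.
From mathcomp Require Import all_classical all_reals all_analysis.
From mathcomp Require Import measurable_realfun ring lra zify.

Set Implicit Arguments.
Unset Strict Implicit.
Unset Printing Implicit Defensive.

Import Order.TTheory GRing.Theory Num.Theory.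
Import numFieldNormedType.Exports.

Local Open Scope classical_set_scope.
Local Open Scope ring_scope.

(* Uniformly over distribution functions H close to a uniformly continuous one,
   the weighted empirical distribution functions of i.i.d. samples from H are
   close to H with high probability: Chebyshev's inequality on a finite grid,
   the variance being at most the sum of the squared weights, which vanishes.
   Hence T - Q, at the empirical distribution functions, is close to
   T (F, G) - Q (F, G) for the actual samples and to T J - Q J = 0 for the
   bootstrap samples.  The critical values are therefore at most a small multiple
   of the scaling factor of the statistics, and no limit law is needed.
   For the Cramer-von Mises statistic, the integral of the square of a
   difference of two distribution functions against a distribution function K
   is continuous in K for the supremum metric. *)

(** * Supremum metrics and grids *)

Section closeness.
Context {R : realType}.

(** The bootstrap law is that of i.i.d. samples from [j] applied to the empirical distribution
    functions, so it changes with the sample sizes and with the outcome. This is why constants and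
    sample size thresholds are fixed before the probability space, or before [H], is introduced.
    Events about suprema are handled without proving them measurable: it is enough to exhibit
    measurable sets of probability close to 1 on which the required inequalities hold pointwise.
    Such sets bound inner probabilities from below, and a lower bound on the distribution function
    of a statistic is an upper bound on its quantile. The measure integrated against in the
    Cramer-von Mises statistic depends on the sample, and closeness of distribution functions in the
    supremum metric controls only measures of orthants. Expanding the square leaves products of
    distribution functions, whose integrals reduce to such measures. *)

Definition sup_lt {l} (e : R) (f g : xfun R l) := forall x, `|f x - g x| < e.

Definition sup_lt2 {m s} (e : R) (K L : xfun2 R m s) :=
  sup_lt e K.1 L.1 /\ sup_lt e K.2 L.2.

Lemma uniform_nbhs_sup_lt {l} (f : xfun R l) (A : set (uxfun R l)) :
  nbhs (f : uxfun R l) A <-> exists2 e : R, 0 < e & forall g, sup_lt e f g -> A g.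
Proof.
split.
  move=> /uniform_nbhs [E [entE EA]].
  move: entE; rewrite -entourage_ballE => -[e /= e0 eE].
  by exists e => // g fg; apply: EA => x _; apply: eE; exact: fg.
move=> [e e0 eA]; apply/uniform_nbhs.
exists [set xy | ball xy.1 e xy.2]; split; first by rewrite -entourage_ballE; exists e.
by move=> g fg; apply: eA => x; exact: (fg x I).
Qed.

Lemma cvg_uniform_sup_lt {l} (f_ : nat -> xfun R l) (f : xfun R l) :
  {uniform, f_ @ \oo --> f} ->
  forall e : R, 0 < e -> \forall n \near \oo, sup_lt e f (f_ n).
Proof.
move=> ff e e0; apply: ff.
by apply/uniform_nbhs_sup_lt; exists e.
Qed.

(** The codomain is left general so that one epsilon-delta form of continuity serves [T] and [Q],
    with values in functions, and [j], with values in pairs. *)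
Lemma within_uniform_nbhs {m s} {E : topologicalType} (D : set (xfun2 R m s))
    (T : xfun2 R m s -> E) (K : xfun2 R m s) (A : set E) :
  {within (D : set (uxfun2 R m s)), continuous (T : uxfun2 R m s -> E)} ->
  D K -> nbhs (T K) A ->
  exists2 e : R, 0 < e & forall L, D L -> sup_lt2 e K L -> A (T L).
Proof.
move=> /subspace_continuousP cT DK TA.
have [[B1 B2] /= [/uniform_nbhs_sup_lt[e1 e10 eB1]]] := cT K DK A TA.
move=> /uniform_nbhs_sup_lt[e2 e20 eB2] B12.
exists (Num.min e1 e2); first by rewrite lt_min e10.
move=> L DL [KL1 KL2]; apply: B12 => //=; split.
  by apply: eB1 => x; rewrite (lt_le_trans (KL1 x))// ge_min lexx.
by apply: eB2 => x; rewrite (lt_le_trans (KL2 x))// ge_min lexx orbT.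
Qed.

Lemma within_uniform_sup_lt {m s u} (D : set (xfun2 R m s))
    (T : xfun2 R m s -> xfun R u) (K : xfun2 R m s) :
  {within (D : set (uxfun2 R m s)),
    continuous (T : uxfun2 R m s -> uxfun R u)} ->
  D K -> forall e : R, 0 < e ->
  exists2 de : R, 0 < de &
    forall L, D L -> sup_lt2 de K L -> sup_lt e (T K) (T L).
Proof.
move=> cT DK e e0.
apply: (@within_uniform_nbhs _ _ (uxfun R u) D T K (sup_lt e (T K))) => //.
by apply/uniform_nbhs_sup_lt; exists e.
Qed.

Lemma within_uniform_sup_lt2 {m s m' s'} (D : set (xfun2 R m s))
    (T : xfun2 R m s -> xfun2 R m' s') (K : xfun2 R m s) :
  {within (D : set (uxfun2 R m s)),
    continuous (T : uxfun2 R m s -> uxfun2 R m' s')} ->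
  D K -> forall e : R, 0 < e ->
  exists2 de : R, 0 < de &
    forall L, D L -> sup_lt2 de K L -> sup_lt2 e (T K) (T L).
Proof.
move=> cT DK e e0.
apply: (@within_uniform_nbhs _ _ (uxfun2 R m' s')%type D T K (sup_lt2 e (T K))) => //.
exists ((fun g => sup_lt e (T K).1 g), (fun g => sup_lt e (T K).2 g)) => //=.
by split; apply/uniform_nbhs_sup_lt; exists e.
Qed.


(** Since [expand] truncates outside [-1, 1], [contract (expand t)] is the projection of [t] onto
    [-1, 1], which cannot increase the distance to a point of that interval. *)
Lemma contract_expand_near (c t h : R) :
  `|c| <= 1 -> `|c - t| <= h -> `|c - contract (expand t)| <= h.
Proof.
move=> c1; have [t1|t1] := leP 1 t.
  rewrite expand1//= => ct; apply: le_trans ct; move: c1.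
  by rewrite ler_norml => /andP[_ ?]; rewrite !ler0_norm//; lra.
have [tN1|tN1] := leP t (-1).
  rewrite expandN1//= => ct; apply: le_trans ct; move: c1.
  by rewrite ler_norml => /andP[? _]; rewrite !ger0_norm//; lra.
by rewrite expandK// inE ler_norml !ltW.
Qed.

(** The uniformity of [\bar R] is that of [-1, 1] pulled back by [contract], so a grid that is
    equally spaced in this scale, infinite endpoints included, brackets every point closely in each
    coordinate. The grid of the product is indexed by finite functions. *)
Lemma unif_continuous_grid {l} (F : xfun R l) (e : R) :
  unif_continuous F -> 0 < e ->
  exists g : seq (xspace R l), forall x, exists lo hi,
    [/\ lo \in g, hi \in g, le_pt lo x && le_pt x hi, `|F x - F lo| < e &
        `|F x - F hi| < e].
Proof.
move=> /unif_continuousP ucF e0.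
have [de de0 Fde] := ucF e e0.
pose h := de / 2; have h0 : 0 < h by rewrite divr_gt0.
(* [contract y + 1] lies in [0, 2], so [k y] is at most [truncn (2 / h)]; one more index is needed
   for the upper neighbour and one for the strict bound of ordinals. *)
pose N := (Num.truncn (2 / h)).+2.
pose gam (k : 'I_N) : \bar R := expand (-1 + k%:R * h).
pose k (y : \bar R) := Num.truncn ((contract y + 1) / h).
have kN y : ((k y).+1 < N)%N.
  rewrite !ltnS; apply: le_truncn; rewrite ler_pM2r ?invr_gt0//.
  by have := contract_le1 y; rewrite ler_norml => /andP[_ ?]; lra.
pose klo y : 'I_N := Ordinal (ltnW (kN y)).
pose khi y : 'I_N := Ordinal (kN y).
have kP y : -1 + (k y)%:R * h <= contract y < -1 + (k y).+1%:R * h.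
  have /truncn_itv : 0 <= (contract y + 1) / h.
    apply: divr_ge0; last exact: ltW.
    by have := contract_le1 y; rewrite ler_norml => /andP[? _]; lra.
  by rewrite -/(k y) ler_pdivlMr// ltr_pdivrMr// => /andP[? ?]; lra.
have nat_succ y : ((k y).+1%:R : R) = (k y)%:R + 1 by rewrite natr1.
exists [seq \row_i gam (f i) | f : {ffun 'I_l -> 'I_N}] => x.
exists (\row_i gam (klo (x ord0 i))), (\row_i gam (khi (x ord0 i))); split.
- apply/mapP; exists [ffun i => klo (x ord0 i)]; first by rewrite mem_enum.
  by apply/rowP => i; rewrite !mxE ffunE.
- apply/mapP; exists [ffun i => khi (x ord0 i)]; first by rewrite mem_enum.
  by apply/rowP => i; rewrite !mxE ffunE.
- apply/andP; split; last first.
    apply/forallP => i; rewrite mxE /gam /= -[leLHS]contractK le_expand//.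
    by have /andP[_ /ltW] := kP (x ord0 i).
  apply/forallP => i; rewrite mxE /gam /= -[leRHS]contractK le_expand//.
  by have /andP[] := kP (x ord0 i).
- apply: (Fde (x, _)); split=> // i j; rewrite /= mxE (ord1 i) /ball/= /ereal_ball.
  apply: (@le_lt_trans _ _ h); last by rewrite /h; lra.
  apply: contract_expand_near; first exact: contract_le1.
  have := kP (x ord0 j); rewrite nat_succ /= => /andP[? ?].
  by rewrite ger0_norm; lra.
- apply: (Fde (x, _)); split=> // i j; rewrite /= mxE (ord1 i) /ball/= /ereal_ball.
  apply: (@le_lt_trans _ _ h); last by rewrite /h; lra.
  apply: contract_expand_near; first exact: contract_le1.
  have := kP (x ord0 j); rewrite nat_succ /= => /andP[? ?].
  by rewrite ler0_norm; lra.
Qed.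

End closeness.

(** * Glivenko-Cantelli by Chebyshev's inequality *)

Section bounded_measurable.
Context {d : measure_display} {Om : measurableType d} {R : realType}.
Variable P : probability Om R.

Lemma bounded_integrable (f : Om -> R) (c : R) :
  measurable_fun setT f -> (forall o, `|f o| <= c) ->
  P.-integrable setT (EFin \o f).
Proof.
move=> mf fc; apply: (@le_integrable _ _ _ _ _ measurableT _ (EFin \o cst c)).
- exact/measurable_EFinP.
- move=> o _ /=; rewrite lee_fin (le_trans (fc o))//.
  exact: ler_norm.
- exact: finite_measure_integrable_cst.
Qed.

Lemma Rintegral_sum n (f : 'I_n -> Om -> R) (c : 'I_n -> R) :
  (forall i, measurable_fun setT (f i)) -> (forall i o, `|f i o| <= c i) ->
  \int[P]_o (\sum_(i < n) f i o) = \sum_(i < n) \int[P]_o f i o.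
Proof.
move=> mf fc.
elim: n f c mf fc => [|n IHn] f c mf fc.
  rewrite big_ord0 (@eq_Rintegral _ _ _ P setT (cst 0)) => [|o _].
    by rewrite (Rintegral_cst P measurableT) mul0r.
  by rewrite big_ord0.
rewrite big_ord_recr /= -(IHn _ (fun i => c (widen_ord (leqnSn n) i)))//.
rewrite -RintegralD//.
- by apply: eq_Rintegral => o _; rewrite big_ord_recr.
- apply: (@bounded_integrable _ (\sum_(i < n) c (widen_ord (leqnSn n) i))).
    exact: measurable_sum.
  by move=> o; rewrite (le_trans (ler_norm_sum _ _ _))// ler_sum.
- exact: (@bounded_integrable _ (c ord_max)).
Qed.

Lemma Rintegral_indic (A : set Om) : measurable A ->
  \int[P]_o \1_A o = fine (P A).
Proof. by move=> mA; rewrite /Rintegral integral_indic// setIT. Qed.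

Lemma covariance_indic (A B : set Om) :
  measurable A -> measurable B ->
  \int[P]_o ((\1_A o - fine (P A)) * (\1_B o - fine (P B))) =
  fine (P (A `&` B)) - fine (P A) * fine (P B).
Proof.
move=> mA mB.
have mI : measurable (A `&` B) by exact: measurableI.
have [p pE] : exists p, p = fine (P A) by eexists.
have [q qE] : exists q, q = fine (P B) by eexists.
have iI (C : set Om) : measurable C ->
    P.-integrable setT (EFin \o (\1_C : Om -> R)).
  move=> mC; apply: (@bounded_integrable _ 1) => // o.
  by rewrite ger0_norm// indicE; case: (_ \in _).
have iZ k (C : set Om) : measurable C ->
    P.-integrable setT (EFin \o (fun o => k * \1_C o)).
  move=> mC; apply: (@bounded_integrable _ `|k|) => [|o].
    exact: measurable_funM.
  by rewrite normrM [X in _ * X]ger0_norm// ler_piMr// indicE; case: (_ \in _).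
have ic k : P.-integrable setT (EFin \o cst k).
  exact: finite_measure_integrable_cst.
rewrite -pE -qE.
transitivity (\int[P]_o ((\1_(A `&` B) o - q * \1_A o) - (p * \1_B o - p * q))).
  by apply: eq_Rintegral => o _; rewrite indicI /=; ring.
rewrite RintegralB//; [|exact: (integrableB measurableT (iI _ mI) (iZ q A mA))
  |exact: (integrableB measurableT (iZ p B mB) (ic (p * q)))].
rewrite (RintegralB measurableT (iI _ mI) (iZ q A mA)).
rewrite (RintegralB measurableT (iZ p B mB) (ic (p * q))).
rewrite RintegralZl//; last exact: iI.
rewrite RintegralZl//; last exact: iI.
rewrite !Rintegral_indic// -pE -qE Rintegral_cst//= probability_setT /=; ring.
Qed.

(** Pairwise independence cancels the off-diagonal covariances, and each diagonal term is at most
    [w i ^+ 2] because [p - p ^+ 2 <= 1] for a probability [p]. *)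
Lemma weighted_indic_chebyshev n (w : 'I_n -> R) (A : 'I_n -> set Om) (e : R) :
  (forall i, measurable (A i)) ->
  (forall i j, i != j -> P (A i `&` A j) = (P (A i) * P (A j))%E) -> 0 < e ->
  let S o := \sum_(i < n) w i * (\1_(A i) o - fine (P (A i))) in
  measurable_fun setT S /\
  fine (P [set o | e <= `|S o| ]) <= (\sum_(i < n) w i ^+ 2) / e ^+ 2.
Proof.
move=> mA indA e0 S.
have mi i : measurable_fun setT (fun o => \1_(A i) o - fine (P (A i))).
  by apply: measurable_funB => //; exact: measurable_indic.
have mwi i : measurable_fun setT (fun o => w i * (\1_(A i) o - fine (P (A i)))).
  exact: measurable_funM.
have bi i o : `|\1_(A i) o - fine (P (A i))| <= 1.
  have p0 : 0 <= fine (P (A i)) by exact: fine_ge0.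
  have p1 : fine (P (A i)) <= 1.
    by rewrite -lee_fin fineK ?fin_num_measure// probability_le1.
  by rewrite indicE; case: (_ \in _); rewrite ler_norml /=; apply/andP; split; lra.
have bwi i o : `|w i * (\1_(A i) o - fine (P (A i)))| <= `|w i|.
  by rewrite normrM ler_piMr.
have mS : measurable_fun setT S by exact: measurable_sum.
split=> //.
set B := [set o | _].
have mB : measurable B.
  rewrite (_ : B = (fun o => `|S o|) @^-1` `[e, +oo[); last first.
    by apply/seteqP; split=> o /=; rewrite in_itv/= andbT.
  rewrite -[X in measurable X]setTI.
  have mN : measurable_fun setT (fun o => `|S o|) by exact: measurableT_comp.
  exact: mN.
have bS o : `|S o| <= \sum_(i < n) `|w i|.
  by rewrite (le_trans (ler_norm_sum _ _ _))// ler_sum.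
have intS2 : \int[P]_o (S o ^+ 2) <= \sum_(i < n) w i ^+ 2.
  pose X i o : R := \1_(A i) o - fine (P (A i)).
  have mX i : measurable_fun setT (X i) by exact: mi.
  have bX i j o : `|X i o * X j o| <= 1.
    by rewrite normrM mulr_ile1 ?normr_ge0 //; exact: bi.
  have mY i j : measurable_fun setT (fun o => w i * w j * (X i o * X j o)).
    by apply: measurable_funM => //; exact: measurable_funM.
  have bY i j o : `|w i * w j * (X i o * X j o)| <= `|w i * w j|.
    by rewrite normrM ler_piMr.
  rewrite (@eq_Rintegral _ _ _ _ _
      (fun o => \sum_(i < n) \sum_(j < n) w i * w j * (X i o * X j o))); last first.
    move=> o _; rewrite expr2 big_distrlr/=; apply: eq_bigr => i _.
    by apply: eq_bigr => j _; rewrite mulrACA.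
  rewrite (@Rintegral_sum _ _ (fun i => \sum_(j < n) `|w i * w j|)) => [|i|i o].
  - apply: ler_sum => i _.
    rewrite (@Rintegral_sum _ _ (fun j => `|w i * w j|))//.
    have XE j : \int[P]_o (w i * w j * (X i o * X j o)) =
        w i * w j * (fine (P (A i `&` A j)) - fine (P (A i)) * fine (P (A j))).
      rewrite RintegralZl//; first by rewrite covariance_indic.
      by apply: (@bounded_integrable _ 1) => //; exact: measurable_funM.
    under eq_bigr do rewrite XE.
    rewrite (bigD1 i)//= big1 ?addr0 => [|j ji].
      rewrite setIid -expr2 -expr2 ler_piMr ?sqr_ge0//.
      have := bi i; have : 0 <= fine (P (A i)) by exact: fine_ge0.
      have : fine (P (A i)) <= 1.
        by rewrite -lee_fin fineK ?fin_num_measure// probability_le1.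
      by nra.
    by rewrite indA 1?eq_sym// fineM ?fin_num_measure// subrr mulr0.
  - exact: measurable_sum.
  - by rewrite (le_trans (ler_norm_sum _ _ _))// ler_sum.
rewrite ler_pdivlMr ?exprn_gt0// mulrC -Rintegral_indic// -RintegralZl//; last first.
  apply: (@bounded_integrable _ 1) => // o.
  by rewrite ger0_norm// indicE; case: (_ \in _).
(* Markov's inequality for the square: [e ^+ 2 * \1_B] is pointwise at most [S ^+ 2]. *)
apply: le_trans intS2; apply: le_Rintegral => //.
- apply: (@bounded_integrable _ (e ^+ 2)) => [|o].
    exact: measurable_funM.
  rewrite normrM [X in X * _]ger0_norm ?sqr_ge0// ler_piMr ?sqr_ge0//.
  by rewrite indicE; case: (_ \in _); rewrite ?normr1 ?normr0.
- apply: (@bounded_integrable _ ((\sum_(i < n) `|w i|) ^+ 2)) => [|o].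
    exact: measurable_funX.
  by rewrite normrX lerXn2r ?nnegrE// (le_trans _ (bS o)).
- move=> o _; rewrite indicE; case: (boolP (o \in B)) => [|_]; last first.
    by rewrite mulr0 sqr_ge0.
  rewrite inE mulr1 -[leRHS]real_normK ?num_real// => ?.
  by rewrite lerXn2r ?nnegrE// ltW.
Qed.

End bounded_measurable.



Section glivenko_cantelli.
Context {R : realType}.

Lemma le_pt_trans {l} (x y z : xspace R l) :
  le_pt x y -> le_pt y z -> le_pt x z.
Proof.
by move=> /forallP xy /forallP yz; apply/forallP => i; exact: le_trans (yz i).
Qed.

(** Union bound with the good event returned as a set, since it later serves as a measurable witness
    for an inner probability. *)
Lemma avoid_sets {d} {Om : measurableType d} (P : probability Om R) {I : eqType}
    (g : seq I) (C : I -> set Om) (c : R) :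
  (forall i, measurable (C i)) -> (forall i, fine (P (C i)) <= c) ->
  exists B : set Om, [/\ measurable B, ((1 - (size g)%:R * c)%:E <= P B)%E &
    forall o i, B o -> i \in g -> ~ C i o].
Proof.
move=> mC cC; elim: g => [|i g [B [mB PB BC]]].
  by exists setT; split => //; rewrite mul0r subr0 probability_setT.
exists (B `\` C i); split; first exact: measurableD.
- rewrite -(@fineK _ (P (B `\` C i))) ?fin_num_measure ?lee_fin//;
    last exact: measurableD.
  have PD : fine (P B) <= fine (P (B `\` C i)) + fine (P (C i)).
    rewrite -lee_fin EFinD !fineK ?fin_num_measure//; last exact: measurableD.
    apply: (@le_trans _ _ (P ((B `\` C i) `|` C i))).
      apply: le_measure; rewrite ?inE//.
        by apply: measurableU => //; exact: measurableD.
      by move=> o Bo; have [?|?] := pselect (C i o); [right|left].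
    by apply: measureU2 => //; exact: measurableD.
  have PB' : 1 - (size g)%:R * c <= fine (P B).
    by rewrite -lee_fin fineK// fin_num_measure.
  by have := cC i; rewrite /= -natr1; lra.
- move=> o k [Bo nC]; rewrite inE => /predU1P[-> //|]; exact: BC.
Qed.

(** [de] is chosen before the probability space, the sample size, the weights and the sample, which
    is the uniformity that the bootstrap requires. At a grid point the error is below [2 * e], half
    from the bias and half from the deviation; monotonicity of the weighted empirical function and
    the oscillation of [F] between neighbours add another [e]. Measurability is asked only of the
    events [le_pt (Y i o) x], so that [Y] can come from real vectors as well as from tuples of
    extended ones. *)
Lemma glivenko_cantelli {l} (F : xfun R l) (e : R) :
  unif_continuous F -> 0 < e ->
  exists2 de : R, 0 < de &
  forall d (Om : measurableType d) (P : probability Om R) n (w : 'I_n -> R)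
    (Y : 'I_n -> Om -> xspace R l),
  (forall i, 0 <= w i) ->
  (forall i x, measurable [set o | le_pt (Y i o) x]) ->
  (forall x i j, i != j ->
    P ([set o | le_pt (Y i o) x] `&` [set o | le_pt (Y j o) x]) =
    (P [set o | le_pt (Y i o) x] * P [set o | le_pt (Y j o) x])%E) ->
  (forall x, `|F x - \sum_(i < n) w i * fine (P [set o | le_pt (Y i o) x])| <= e) ->
  \sum_(i < n) w i ^+ 2 <= de ->
  exists B : set Om, [/\ measurable B, ((1 - e)%:E <= P B)%E &
    forall o, B o ->
      sup_lt (3 * e) F (fun x => \sum_(i < n) w i * (le_pt (Y i o) x)%:R)].
Proof.
move=> ucF e0.
have [g gP] := unif_continuous_grid ucF e0.
(* Each grid point is bad with probability at most [de / e ^+ 2], and this choice makes the sum over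
   the grid at most [e]; the successor keeps the divisor nonzero. *)
exists (e ^+ 3 / (size g).+1%:R); first by rewrite divr_gt0 ?exprn_gt0.
move=> d Om P n w Y w0 mY indY meanF w2.
pose A x (i : 'I_n) := [set o | le_pt (Y i o) x].
pose S x o := \sum_(i < n) w i * (\1_(A x i) o - fine (P (A x i))).
have cheb x : measurable_fun setT (S x) /\
    fine (P [set o | e <= `|S x o| ]) <= (\sum_(i < n) w i ^+ 2) / e ^+ 2.
    by apply: weighted_indic_chebyshev => // [i|i j]; [exact: mY|exact: indY].
have mC x : measurable [set o | e <= `|S x o|].
  rewrite (_ : [set o | _] = (fun o => `|S x o|) @^-1` `[e, +oo[); last first.
    by apply/seteqP; split=> o /=; rewrite in_itv/= andbT.
  rewrite -[X in measurable X]setTI.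
  have mN : measurable_fun setT (fun o => `|S x o|).
    by apply: (measurableT_comp (@normr_measurable R setT)); exact: (cheb x).1.
  exact: mN.
have [B [mB PB BC]] := avoid_sets g mC (fun x => (cheb x).2).
exists B; split => //.
  apply: le_trans PB; rewrite lee_fin lerD2l lerN2 mulrA ler_pdivrMr ?exprn_gt0//.
  rewrite -exprS; apply: (@le_trans _ _ ((size g).+1%:R * (e ^+ 3 / (size g).+1%:R))).
    by apply: ler_pM => //; [by apply: sumr_ge0 => i _; exact: sqr_ge0|rewrite ler_nat].
  by rewrite mulrCA divff ?pnatr_eq0// mulr1.
move=> o Bo.
pose emp x := \sum_(i < n) w i * (le_pt (Y i o) x)%:R.
have emp_le x y : le_pt x y -> emp x <= emp y.
  move=> xy; apply: ler_sum => i _; apply: ler_wpM2l => //.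
  rewrite ler_nat; case: (boolP (le_pt (Y i o) x)) => // Yx.
  by rewrite (le_pt_trans Yx xy).
have grid x : x \in g -> `|F x - emp x| < 2 * e.
  move=> xg; have /negP := BC o x Bo xg; rewrite -ltNge => Sx.
  have SE : S x o = emp x - \sum_(i < n) w i * fine (P (A x i)).
    rewrite /S /emp -sumrB; apply: eq_bigr => i _; rewrite mulrBr indicE.
    by congr (_ * (nat_of_bool _)%:R - _); apply/idP/idP; rewrite inE.
  move: (meanF x) Sx; rewrite SE ler_norml !ltr_norml => /andP[? ?] /andP[? ?].
  by apply/andP; split; lra.
move=> x; have [lo [hi [glo ghi /andP[lox xhi] Flo Fhi]]] := gP x.
have := emp_le _ _ lox; have := emp_le _ _ xhi.
move: (grid _ glo) (grid _ ghi) Flo Fhi; rewrite -/(emp x) !ltr_norml.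
move=> /andP[? ?] /andP[? ?] /andP[? ?] /andP[? ?] ? ?.
by apply/andP; split; lra.
Qed.

End glivenko_cantelli.


(** * Orthants and distribution functions *)

Section orthants.
Context {R : realType} {l : nat}.
Implicit Types x y z : xspace R l.

Lemma continuous_coord (E : topologicalType) (i : 'I_l) :
  continuous (fun z : 'rV[E]_l => z ord0 i).
Proof.
move=> z A zA; exists (fun i' j => [set y | i' = ord0 -> j = i -> A y]).
  move=> i' j; rewrite (ord1 i').
  have [->|/eqP ji] := eqVneq j i; first by apply: filterS zA => y ? _.
  by apply: filterS (filterT : nbhs _ setT) => y _ _ /ji.
by move=> y /(_ ord0 i); exact.
Qed.

Lemma open_borel_measurable (T : ptopologicalType) (A : set T) :
  open A -> measurable (A : set (borel T)).
Proof. by move=> oA; exact: sub_sigma_algebra. Qed.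

Lemma closed_borel_measurable (T : ptopologicalType) (A : set T) :
  closed A -> measurable (A : set (borel T)).
Proof.
move=> cA; rewrite -[A]setCK; apply: measurableC.
by apply: open_borel_measurable; exact: closed_openC.
Qed.

Lemma measurable_coord (i : 'I_l) :
  measurable_fun setT (fun z : borel (xspace R l) => z ord0 i : \bar R).
Proof.
apply: (measurability _ (@ErealGenCInfty.measurableE R)) => _ [_ [r ->] <-].
rewrite setTI; apply: closed_borel_measurable.
apply: closed_comp; first by move=> z _; exact: continuous_coord.
by rewrite set_itvE; exact: closed_ereal_le_ereal.
Qed.

(** Stated in the product sigma-algebra so that sections are available: they give the measurability
    of lower orthants, and their measures that of distribution functions. *)
Lemma measurable_le_pt_rel : measurable
  [set p : borel (xspace R l) * borel (xspace R l) | le_pt p.1 p.2].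
Proof.
rewrite (_ : [set p | _] = \bigcap_(i in [set: 'I_l])
  [set p : borel (xspace R l) * borel (xspace R l) | (p.1 ord0 i <= p.2 ord0 i)%E]).
  apply: fin_bigcap_measurable => // i _.
  rewrite -[X in measurable X]setTI; apply: measurable_lee => //.
    exact: (measurableT_comp (measurable_coord i) measurable_fst).
  exact: (measurableT_comp (measurable_coord i) measurable_snd).
apply/seteqP; split => p /=; first by move=> /forallP + i _; exact.
by move=> H; apply/forallP => i; exact: H.
Qed.

Lemma measurable_lower_orthant x :
  measurable [set z : borel (xspace R l) | le_pt z x].
Proof.
have := measurable_ysection (x : borel (xspace R l)) measurable_le_pt_rel.
by rewrite /ysection/=; congr measurable; apply/seteqP; split=> z /=; rewrite inE.
Qed.

Lemma measurable_ext_pt_le x :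
  measurable [set z : borel 'rV[R]_l | le_pt (ext_pt z) x].
Proof.
rewrite (_ : [set z | _] = \bigcap_(i in [set: 'I_l])
  [set z : borel 'rV[R]_l | ((z ord0 i)%:E <= x ord0 i)%E]); last first.
  apply/seteqP; split => p /=; first by move=> /forallP + i _ => /(_ i); rewrite mxE.
  by move=> H; apply/forallP => i; rewrite mxE; exact: H.
apply: fin_bigcap_measurable => // i _; apply: closed_borel_measurable.
rewrite -[X in closed X]setCK; apply: open_closedC.
rewrite (_ : ~` _ = (fun z : 'rV[R]_l => z ord0 i) @^-1` [set r | (x ord0 i < r%:E)%E]).
  apply: open_comp; first by move=> z _; exact: continuous_coord.
  exact: open_ereal_gt.
by apply/seteqP; split => z /=; rewrite ltNge => /negP.
Qed.

End orthants.

(** [mnormalize] leaves a measure of total mass 1 unchanged and equips it with the structure of a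
    probability; [Q] is the fallback value that it takes as an argument. *)
Lemma measure_probability {d} {T : measurableType d} {R : realType}
    (mu : {measure set T -> \bar R}) (Q : probability T R) :
  mu setT = 1%E -> exists P : probability T R, forall A, P A = mu A.
Proof.
move=> mu1; exists (mnormalize mu Q) => A.
by rewrite /= /mnormalize mu1 onee_eq0/= invr1 mule1.
Qed.

Section distfun_facts.
Context {R : realType} {l : nat}.
Implicit Types (K : xfun R l).

Lemma df_probP K : distfun l K -> is_df_of K (df_prob K).
Proof. by move=> [mu Kmu]; rewrite /df_prob; apply: xgetPex; exists mu. Qed.

Lemma distfunE K x : distfun l K ->
  K x = fine (df_prob K [set z | le_pt z x]).
Proof. by move=> /df_probP ->. Qed.

Lemma distfun_ge0 K x : distfun l K -> 0 <= K x.
Proof. by move=> dK; rewrite (distfunE x dK) fine_ge0. Qed.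

Lemma distfun_le1 K x : distfun l K -> K x <= 1.
Proof.
move=> /df_probP Kmu; rewrite -lee_fin -Kmu; apply: probability_le1.
exact: measurable_lower_orthant.
Qed.

Lemma measurable_distfun K : distfun l K ->
  measurable_fun setT (K : borel (xspace R l) -> R).
Proof.
move=> /df_probP Kmu; apply/measurable_EFinP.
have := measurable_fun_ysection (df_prob K) (@measurable_le_pt_rel R l).
apply: eq_measurable_fun => x _ /=; rewrite -Kmu; congr (df_prob K _).
by apply/seteqP; split=> z /=; rewrite /ysection/= inE.
Qed.

Lemma distfun_wecdf (w : nat -> nat -> R) n (x : 'I_n -> xspace R l) :
  (0 < n)%N -> (forall i, (i < n)%N -> 0 <= w n i) -> \sum_(i < n) w n i = 1 ->
  distfun l (wecdf w x).
Proof.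
move=> n0 w0 w1.
(* [msum] expects measures indexed by all naturals: [insubd] supplies a default point and the
   absolute value a nonnegative mass for indices from [n] on, which the sum ignores. *)
pose X i := x (insubd (Ordinal n0) i).
pose m i : {measure set (borel (xspace R l)) -> \bar R} :=
  mscale (NngNum (normr_ge0 (w n i))) (\d_(X i : borel (xspace R l))).
pose mu := msum m n.
have muE A : mu A = (\sum_(i < n) w n i * \1_A (x i))%:E.
  rewrite /mu/= /msum -sumEFin; apply: eq_bigr => i _.
  rewrite /m /= /mscale /= ger0_norm ?w0// diracE EFinM; congr (_ * _)%E.
  by rewrite /X valKd indicE.
have mu1 : mu setT = 1%E.
  rewrite muE; congr EFin; rewrite -[RHS]w1.
  by apply: eq_bigr => i _; rewrite indicT mulr1.
have [P PE] := measure_probability (\d_(X 0%N : borel (xspace R l))) mu1.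
exists P => t; rewrite PE; apply: etrans (muE _) _.
congr EFin; apply: eq_bigr => i _.
by rewrite indicE mem_setE.
Qed.

End distfun_facts.


(** * Continuity of integrals in the integrating distribution function *)

Section integral_continuity.
Context {R : realType}.

(** Writes an open lower half-line as an increasing union of closed ones, also for [c = +oo]: the
    endpoints approach [c] from below in the scale of [contract]. *)
Lemma ereal_lt_approx (c : \bar R) : c != -oo%E ->
  exists q : nat -> \bar R, nondecreasing_seq q /\
    forall y, (y < c)%E <-> exists n, (y <= q n)%E.
Proof.
move=> cNy.
exists (fun n => expand (contract c - n.+1%:R^-1)); split.
  move=> n p np; apply: le_expand; rewrite lerB// lef_pV2 ?posrE//.
  by rewrite ler_nat.
move=> y; split=> [yc|[n yn]].
  have yc0 : 0 < contract c - contract y by rewrite subr_gt0 lt_contract.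
  exists (Num.truncn (contract c - contract y)^-1).
  rewrite -[leLHS]contractK le_expand// lerBrDr -lerBrDl.
  rewrite invf_ple ?posrE//; exact/ltW/truncnS_gt.
apply: le_lt_trans yn _; set t := contract c - _.
have tc : t < contract c by rewrite ltrBlDr ltrDl invr_gt0.
have [tN1|tN1] := leP t (-1); first by rewrite expandN1// ltNye.
rewrite -lt_contract expandK// inE ler_norml ltW//=.
apply: ltW; apply: lt_le_trans tc _.
by have := contract_le1 c; rewrite ler_norml => /andP[].
Qed.

Lemma bigcup_measure_close {d} {T : measurableType d} (P Q : probability T R)
    (F : nat -> set T) (c : R) :
  (forall n, measurable (F n)) -> nondecreasing_seq F ->
  (forall n, `|fine (P (F n)) - fine (Q (F n))| <= c) ->
  `|fine (P (\bigcup_n F n)) - fine (Q (\bigcup_n F n))| <= c.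
Proof.
move=> mF ndF PQ.
have mU : measurable (\bigcup_n F n) by exact: bigcup_measurable.
have cvgP (S : probability T R) :
    (fun n => fine (S (F n))) @ \oo --> fine (S (\bigcup_n F n)).
  apply: fine_cvg; rewrite fineK ?fin_num_measure//.
  exact: nondecreasing_cvg_mu.
have : (fun n => `|fine (P (F n)) - fine (Q (F n))|) @ \oo -->
    `|fine (P (\bigcup_n F n)) - fine (Q (\bigcup_n F n))|.
  by apply: cvg_norm; apply: cvgB; exact: cvgP.
move=> /cvgr_to_le; apply; exact: nearW.
Qed.

Variable l : nat.

(** Interpolates between lower orthants, at [k = 0], and upper orthants, at [k = l]. *)
Let mixed (k : nat) (w x : xspace R l) : set (borel (xspace R l)) :=
  [set z | forall i : 'I_l,
    if (i < k)%N then (w ord0 i <= z ord0 i)%E else (z ord0 i <= x ord0 i)%E].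

Let upd (x : xspace R l) (k : 'I_l) (c : \bar R) : xspace R l :=
  \row_i (if i == k then c else x ord0 i).

Let measurable_mixed k w x : measurable (mixed k w x).
Proof.
rewrite (_ : mixed k w x = \bigcap_(i in [set: 'I_l])
  [set z | if (i < k)%N then (w ord0 i <= z ord0 i)%E else (z ord0 i <= x ord0 i)%E]).
  apply: fin_bigcap_measurable => // i _; case: (i < k)%N.
    by rewrite -[X in measurable X]setTI; exact: (measurable_lee measurableT
      (measurable_cst _) (measurable_coord i)).
  by rewrite -[X in measurable X]setTI; exact: (measurable_lee measurableT
    (measurable_coord i) (measurable_cst _)).
by apply/seteqP; split => z /= H i; [move=> _|]; exact: H.
Qed.

Lemma upper_orthant_close (P Q : probability (borel (xspace R l)) R) (e : R) :
  (forall x, `|fine (P [set z | le_pt z x]) - fine (Q [set z | le_pt z x])| <= e) ->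
  forall w, `|fine (P [set z | le_pt w z]) - fine (Q [set z | le_pt w z])| <= 2 ^+ l * e.
Proof.
move=> PQ w.
have e0 : 0 <= e by apply: le_trans (PQ w).
suff H k : (k <= l)%N -> forall x,
    `|fine (P (mixed k w x)) - fine (Q (mixed k w x))| <= 2 ^+ k * e.
  rewrite (_ : [set z | _] = mixed l w w); first exact: H.
  apply/seteqP; split => z /=; first by move=> /forallP wz i; rewrite ltn_ord.
  by move=> H'; apply/forallP => i; have := H' i; rewrite ltn_ord.
(* One coordinate is flipped at a time: [w_k <= z_k] is the complement of
   [z_k < w_k], which is the increasing union of the [z_k <= q n]. *)
elim: k => [_ x|k IHk kl x].
  rewrite expr0 mul1r (_ : mixed 0 w x = [set z | le_pt z x])//.
  apply/seteqP; split => z /=; first by move=> H; apply/forallP => i; exact: H.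
  by move=> /forallP.
pose k' := Ordinal kl.
(* The bound [+oo] frees coordinate [k]; what has to be removed afterwards is exactly [C]. *)
pose x' := upd x k' +oo%E.
pose C := mixed k w x' `&` [set z | (z ord0 k' < w ord0 k')%E].
have mC : measurable C.
  apply: measurableI => //; rewrite -[X in measurable X]setTI.
  exact: (measurable_lte measurableT (measurable_coord k') (measurable_cst _)).
have sC : C `<=` mixed k w x' by move=> z [].
have -> : mixed k.+1 w x = mixed k w x' `\` C.
  apply/seteqP; split => z.
    move=> H; split.
      move=> i; have := H i; rewrite ltnS leq_eqVlt /x' mxE.
      have [->|ik] := eqVneq i k'; first by rewrite ltnn leey.
      by rewrite (_ : (i == k :> nat) = false)//; exact/negbTE.
    move=> [_ /=]; have := H k'; rewrite ltnS leqnn => wz.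
    by rewrite ltNge wz.
  move=> [H nC] i; have := H i; rewrite ltnS [(i <= k)%N]leq_eqVlt /x' mxE.
  have [->|ik] := eqVneq i k'.
    by move=> _; rewrite /= eqxx /= leNgt; apply/negP => zw; apply: nC.
  by rewrite (_ : (i == k :> nat) = false)//; exact/negbTE.
have CPQ : `|fine (P C) - fine (Q C)| <= 2 ^+ k * e.
  (* Nothing lies below [-oo], so [C] is then empty; [ereal_lt_approx] does not cover this case. *)
  have [wNy|wNy] := eqVneq (w ord0 k') -oo%E.
    rewrite (_ : C = set0) ?measure0 ?subrr ?normr0 ?mulr_ge0//.
    by rewrite -subset0 => z [_ /=]; rewrite wNy ltNge leNye.
  have [q [ndq qP]] := ereal_lt_approx wNy.
  rewrite (_ : C = \bigcup_n mixed k w (upd x k' (q n))).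
    apply: bigcup_measure_close => //.
    - move=> n p np; rewrite subsetEset => z H i; have := H i.
      case: ifP => // _; rewrite !mxE; case: ifP => // _ /le_trans; apply.
      exact: ndq.
    - by move=> n; apply: IHk; exact: ltnW.
  apply/seteqP; split => z.
    move=> [H /= /qP[n zq]]; exists n => // i; have := H i.
    by case: ifP => // _; rewrite !mxE; case: ifP => // /eqP ->.
  move=> [n _ H]; split.
    move=> i; have := H i; case: ifP => // _; rewrite !mxE; case: ifP => // _ _.
    exact: leey.
  by apply/qP; exists n; have := H k'; rewrite ltnn mxE eqxx.
(* Both sets in the difference obey the bound [2 ^+ k * e], so each flip doubles the constant. *)
have PD (mu : probability (borel (xspace R l)) R) :
    fine (mu (mixed k w x' `\` C)) = fine (mu (mixed k w x')) - fine (mu C).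
  rewrite measureD//; last by rewrite ltey_eq fin_num_measure.
  rewrite fineB ?fin_num_measure//; last exact: measurableI.
  by rewrite (setIidr sC).
have := IHk (ltnW kl) x'; move: CPQ; rewrite !PD exprS -mulrA.
rewrite !ler_norml => /andP[? ?] /andP[? ?]; apply/andP; split; lra.
Qed.

Let max_pt (x y : xspace R l) : xspace R l :=
  \row_i Order.max (x ord0 i) (y ord0 i).

(* By Fubini both integrals are integrals of measures of upper orthants. *)
Lemma Rintegral_distfunM_close (L1 L2 K K' : xfun R l) (e : R) :
  distfun l L1 -> distfun l L2 -> distfun l K -> distfun l K' ->
  (forall x, `|K x - K' x| <= e) ->
  `|\int[df_prob K]_z (L1 z * L2 z) - \int[df_prob K']_z (L1 z * L2 z)| <=
    2 ^+ l * e.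
Proof.
move=> dL1 dL2 dK dK' KK'.
pose lam : probability _ R := (df_prob L1 \x df_prob L2)%E.
(* [L1 z * L2 z] is the [lam]-measure of the section of [S] at [z], while the section at a pair [w]
   is the upper orthant of its componentwise maximum. *)
pose S := [set p : (borel (xspace R l) * borel (xspace R l)) * borel (xspace R l) |
  le_pt p.1.1 p.2 /\ le_pt p.1.2 p.2].
have mS : measurable S.
  rewrite (_ : S =
    (fun p => (p.1.1, p.2)) @^-1` [set p | le_pt p.1 p.2] `&`
    (fun p => (p.1.2, p.2)) @^-1` [set p | le_pt p.1 p.2])//.
  apply: measurableI.
    rewrite -[X in measurable X]setTI.
    apply: (measurable_fun_pair (f := fun p => p.1.1) (g := snd)) => //.
      exact: (measurableT_comp measurable_fst measurable_fst).
    exact: measurable_le_pt_rel.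
  rewrite -[X in measurable X]setTI.
  apply: (measurable_fun_pair (f := fun p => p.1.2) (g := snd)) => //.
    exact: (measurableT_comp measurable_snd measurable_fst).
  exact: measurable_le_pt_rel.
have xS w : xsection S w = [set z | le_pt (max_pt w.1 w.2) z].
  apply/seteqP; split => z; rewrite /xsection/= inE /S/=.
    move=> [/forallP wz1 /forallP wz2]; apply/forallP => i.
    by rewrite mxE ge_max wz1 wz2.
  by move=> /forallP H; split; apply/forallP => i; have := H i;
    rewrite mxE ge_max => /andP[].
have yS z : ysection S z = [set w | le_pt w z] `*` [set w | le_pt w z].
  by apply/seteqP; split => w; rewrite /ysection/= inE.
pose h (mu : probability (borel (xspace R l)) R) w := fine (mu (xsection S w)).
have mh mu : measurable_fun setT (h mu).
  apply/measurable_EFinP.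
  have := measurable_fun_xsection mu mS.
  apply: eq_measurable_fun => w _ /=.
  by rewrite fineK// fin_num_measure//; exact: measurable_xsection.
have h1 mu w : `|h mu w| <= 1.
  rewrite ger0_norm ?fine_ge0// -lee_fin fineK ?fin_num_measure ?probability_le1//;
    exact: measurable_xsection.
have HE (H : xfun R l) : distfun l H ->
    \int[df_prob H]_z (L1 z * L2 z) = \int[lam]_w h (df_prob H) w.
  move=> dH; rewrite /Rintegral; congr fine.
  have := indic_fubini_tonelli lam (df_prob H) mS.
  rewrite indic_fubini_tonelli_FE// indic_fubini_tonelli_GE//.
  rewrite (eq_integral (fun w => (h (df_prob H) w)%:E)); last first.
    by move=> w _; rewrite /= fineK// fin_num_measure//; exact: measurable_xsection.
  move=> ->; apply: eq_integral => z _ /=.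
  rewrite yS.
  have := product_measure1E (df_prob L1) (df_prob L2) (measurable_lower_orthant z)
    (measurable_lower_orthant z).
  by rewrite /= (df_probP dL1) (df_probP dL2) -EFinM.
rewrite !HE// -RintegralB//; try exact: (@bounded_integrable _ _ _ _ _ 1).
apply: le_trans (le_normr_Rintegral _ _) _ => //.
  apply: (@bounded_integrable _ _ _ _ _ 2); first exact: measurable_funB.
  by move=> w; rewrite (le_trans (ler_normB _ _))// [leRHS](_ : 2 = 1 + 1)// lerD.
have int2 : 2 ^+ l * e = \int[lam]_w (cst (2 ^+ l * e) w).
  by rewrite Rintegral_cst//= probability_setT mulr1.
rewrite int2; apply: le_Rintegral => //.
- apply: (@bounded_integrable _ _ _ _ _ 2).
    by apply: (measurableT_comp (@normr_measurable R setT)); exact: measurable_funB.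
  move=> w; rewrite normr_id (le_trans (ler_normB _ _))//.
  by rewrite [leRHS](_ : 2 = 1 + 1)// lerD.
- exact: finite_measure_integrable_cst.
- move=> w _; rewrite /h xS; apply: upper_orthant_close => x.
  by rewrite (df_probP dK) (df_probP dK'); exact: KK'.
Qed.

(** The expanded square consists of four products of distribution functions, counted with
    multiplicity, each contributing an error of [2 ^+ l * e]. *)
Lemma Rintegral_sqr_distfunB_close (L1 L2 K K' : xfun R l) (e : R) :
  distfun l L1 -> distfun l L2 -> distfun l K -> distfun l K' ->
  (forall x, `|K x - K' x| <= e) ->
  `|\int[df_prob K]_z ((L1 z - L2 z) ^+ 2) -
    \int[df_prob K']_z ((L1 z - L2 z) ^+ 2)| <= 4 * (2 ^+ l * e).
Proof.
move=> dL1 dL2 dK dK' KK'.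
have iM (A B : xfun R l) (mu : probability (borel (xspace R l)) R) :
    distfun l A -> distfun l B -> mu.-integrable setT (EFin \o (fun z => A z * B z)).
  move=> dA dB; apply: (@bounded_integrable _ _ _ _ _ 1).
    by apply: measurable_funM; exact: measurable_distfun.
  move=> z; rewrite normrM mulr_ile1 ?normr_ge0// ger0_norm ?distfun_ge0//;
    exact: distfun_le1.
have E (mu : probability (borel (xspace R l)) R) :
    \int[mu]_z ((L1 z - L2 z) ^+ 2) =
    (\int[mu]_z (L1 z * L1 z) - \int[mu]_z (L1 z * L2 z)) -
    (\int[mu]_z (L1 z * L2 z) - \int[mu]_z (L2 z * L2 z)).
  rewrite -!RintegralB//; try exact: iM; try by
    have := integrableB measurableT (iM _ _ mu dL1 dL1) (iM _ _ mu dL1 dL2).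
  - by apply: eq_Rintegral => z _; ring.
  - by have := integrableB measurableT (iM _ _ mu dL1 dL2) (iM _ _ mu dL2 dL2).
rewrite !E.
have := Rintegral_distfunM_close dL1 dL1 dK dK' KK'.
have := Rintegral_distfunM_close dL1 dL2 dK dK' KK'.
have := Rintegral_distfunM_close dL2 dL2 dK dK' KK'.
rewrite !ler_norml => /andP[? ?] /andP[? ?] /andP[? ?]; apply/andP; split; lra.
Qed.

End integral_continuity.


(** * Empirical distribution functions *)

Section pairwise_independence.
Context {R : realType}.

Section product_rule.
Context {d d' : measure_display} {T : measurableType d} {E : measurableType d'}.
Variables (P : probability T R) (n : nat) (X : 'I_n -> T -> E).
Hypothesis product_rule : forall A : 'I_n -> set E, (forall i, measurable (A i)) ->
  P [set o | forall i, A i (X i o)] = (\prod_(i < n) fine (P (X i @^-1` A i)))%:E.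

(** The product rule with [setT] at every index other than [i] and [j]. It is abstracted to serve
    both the observations and the coordinates of an i.i.d. tuple. *)
Lemma product_rule_pairwise (C : set E) (i j : 'I_n) :
  (forall k, measurable (X k @^-1` C)) -> measurable C -> i != j ->
  P (X i @^-1` C `&` X j @^-1` C) = (P (X i @^-1` C) * P (X j @^-1` C))%E.
Proof.
move=> mXC mC ij.
pose A k := if (k == i) || (k == j) then C else setT.
have mA k : measurable (A k) by rewrite /A; case: ifP.
rewrite -(@fineK _ (P (X i @^-1` C))) ?fin_num_measure//.
rewrite -(@fineK _ (P (X j @^-1` C))) ?fin_num_measure// -EFinM.
rewrite (_ : _ `&` _ = [set o | forall k, A k (X k o)]); last first.
  apply/seteqP; split => o /=; last first.
    by move=> H; have := H i; have := H j; rewrite /A !eqxx orbT.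
  move=> [Ci Cj] k; rewrite /A; case: eqP => [->//|_].
  by case: eqP => [->|].
rewrite product_rule//; congr EFin.
rewrite (bigD1 i)// (bigD1 j)/=; last by rewrite eq_sym.
rewrite /A !eqxx orbT big1 ?mulr1// => k /andP[/negbTE-> /negbTE->] /=.
by rewrite preimage_setT probability_setT.
Qed.

End product_rule.

Lemma independent_seq_product_rule {d d'} {T : measurableType d}
    {E : measurableType d'} (P : probability T R) (X : nat -> {RV P >-> E}) n
    (A : 'I_n -> set E) :
  independent_seq X -> (forall i, measurable (A i)) ->
  P [set o | forall i, A i (X i o)] =
  (\prod_(i < n) fine (P (X i @^-1` A i)))%:E.
Proof.
move=> indX mA.
pose A' k := oapp A setT (insub k).
have A'E (i : 'I_n) : A' i = A i by rewrite /A' valK.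
have mA' k : measurable (A' k) by rewrite /A'; case: insub => //=.
rewrite (_ : [set o | _] = \bigcap_(i in `I_n) (X i @^-1` A' i)).
  by rewrite indX//; congr EFin; apply: eq_bigr => i _; rewrite A'E.
apply/seteqP; split => o /= H i.
  by move=> ni; have := H (Ordinal ni); rewrite -A'E.
by have := H i (ltn_ord i); rewrite A'E.
Qed.

Lemma iid_prob_product {d} {E : measurableType d} (P : probability E R) n
    (A : 'I_n -> set E) : (forall i, measurable (A i)) ->
  iid_prob P n [set t | forall i, A i (tnth t i)] =
  (\prod_(i < n) fine (P (A i)))%:E.
Proof.
elim: n A => [|n IHn] A mA.
  by rewrite big_ord0 /= diracE mem_set// => -[].
have mB : measurable [set t : n.-tuple E | forall i, A (lift ord0 i) (tnth t i)].
  rewrite (_ : [set t | _] = \bigcap_(i in [set: 'I_n])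
      ((fun t : n.-tuple E => tnth t i) @^-1` A (lift ord0 i))).
    apply: fin_bigcap_measurable => // i _; rewrite -[X in measurable X]setTI.
    exact: measurable_tnth.
  by apply/seteqP; split => t /= H i; [move=> _|]; exact: H.
rewrite /= /distribution /pushforward.
rewrite (_ : _ @^-1` _ = A ord0 `*`
    [set t : n.-tuple E | forall i, A (lift ord0 i) (tnth t i)]); last first.
  apply/seteqP; split => -[x t] /=.
    by move=> H; split=> [|i]; [have := H ord0|have := H (lift ord0 i)]; rewrite ?tnthS.
  move=> [H0 H] i; case: (unliftP ord0 i) => [k|] ->; last by [].
  by rewrite tnthS.
rewrite product_measure1E//= (IHn (fun i => A (lift ord0 i)))//.
by rewrite big_ord_recl EFinM fineK// fin_num_measure.
Qed.

Lemma iid_prob_tnth {d} {E : measurableType d} (P : probability E R) n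
    (C : set E) (i : 'I_n) : measurable C ->
  iid_prob P n [set t | C (tnth t i)] = P C.
Proof.
move=> mC.
pose A k := if k == i then C else setT.
have mA k : measurable (A k) by rewrite /A; case: ifP.
rewrite (_ : [set t | _] = [set t | forall k, A k (tnth t k)]); last first.
  apply/seteqP; split => t /=; last by move/(_ i); rewrite /A eqxx.
  by move=> Ci k; rewrite /A; case: eqP => [->|].
rewrite iid_prob_product// (bigD1 i)//= big1 => [|k /negbTE ki].
  by rewrite /A eqxx mulr1 fineK// fin_num_measure.
by rewrite /A ki probability_setT.
Qed.

End pairwise_independence.

(** * Weights and weighted means *)

Section weights.
Context {R : realType}.

(** The last clause makes the Chebyshev bound vanish and forces every single weight to become
    small. *)
Definition vanishing_weights (w : nat -> nat -> R) :=
  [/\ forall n i, (i < n)%N -> 0 <= w n i,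
      forall n, (0 < n)%N -> \sum_(i < n) w n i = 1 &
      forall e : R, 0 < e -> \forall n \near \oo, \sum_(i < n) w n i ^+ 2 <= e].

(** A convergent sequence is bounded, so the sum of squares is eventually at most
    [(|c| + 1) / n]. *)
Lemma cvg_sum_sqr_vanishing (w : nat -> nat -> R) (c : R) :
  (fun n => n%:R * \sum_(i < n) w n i ^+ 2) @ \oo --> c ->
  forall e : R, 0 < e -> \forall n \near \oo, \sum_(i < n) w n i ^+ 2 <= e.
Proof.
move=> wc e e0.
have /cvgr_norm_le := wc; move=> /(_ (`|c| + 1)) H.
near=> n.
have n0 : (0 < n)%N by near: n; exact: nbhs_infty_gt.
have nw : `|n%:R * \sum_(i < n) w n i ^+ 2| <= `|c| + 1.
  by near: n; apply: H; rewrite ltrDl.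
have ne : (`|c| + 1) / e <= n%:R by near: n; exact: nbhs_infty_ger.
move: nw; rewrite ger0_norm; last first.
  by rewrite mulr_ge0// sumr_ge0// => i _; exact: sqr_ge0.
rewrite ler_pdivrMr// in ne => nw.
by rewrite -(@ler_pM2l _ n%:R) ?ltr0n// (le_trans nw).
Unshelve. all: by end_near. Qed.

(** A Toeplitz argument for observations that need not be identically distributed: late indices
    contribute at most [e / 2] because the total weight is 1, and the finitely many early ones carry
    little weight. *)
Lemma weighted_mean_close {l} (w : nat -> nat -> R) (F_ : nat -> xfun R l)
    (F : xfun R l) :
  vanishing_weights w -> (forall i x, `|F x - F_ i x| <= 1) ->
  {uniform, F_ @ \oo --> F} ->
  forall e : R, 0 < e -> \forall n \near \oo, forall x,
    `|F x - \sum_(i < n) w n i * F_ i x| <= e.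
Proof.
move=> [w0 w1 w2] FF1 FF e e0.
have e20 : 0 < e / 2 by rewrite divr_gt0.
have [N _ HN] := cvg_uniform_sup_lt FF e20.
(* The early indices cost at most [N * eta <= e / 4], and the squares divided by [eta] another
   [e / 4]. *)
pose eta := e / 4 / N.+1%:R.
have eta0 : 0 < eta by rewrite !divr_gt0.
have sq := w2 (eta * (e / 4)); near=> n => x.
have n0 : (0 < n)%N by near: n; exact: nbhs_infty_gt.
have sqn : \sum_(i < n) w n i ^+ 2 <= eta * (e / 4).
  by near: n; apply: sq; rewrite mulr_gt0// divr_gt0.
have -> : F x - \sum_(i < n) w n i * F_ i x = \sum_(i < n) w n i * (F x - F_ i x).
  under [RHS]eq_bigr do rewrite mulrBr.
  by rewrite sumrB -mulr_suml w1// mul1r.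
apply: le_trans (ler_norm_sum _ _ _) _.
(* For [i < N], where [F_ i] may be far from [F]: [w <= eta + w ^ 2 / eta]. *)
pose ind (i : nat) : R := (i < N)%N%:R.
apply: (@le_trans _ _ (\sum_(i < n)
    (w n i * (e / 2) + (eta * ind i + w n i ^+ 2 / eta)))).
  apply: ler_sum => i _; rewrite normrM ger0_norm ?w0//.
  have wi : 0 <= w n i by exact: w0.
  have sq0 : 0 <= w n i ^+ 2 / eta by rewrite divr_ge0 ?sqr_ge0 ?ltW.
  have we0 : 0 <= w n i * (e / 2) by rewrite mulr_ge0// ltW.
  rewrite /ind; have [iN|Ni] := ltnP i N.
    apply: (@le_trans _ _ (w n i)); first by rewrite ler_piMr.
    rewrite mulr1; have [wle|wgt] := leP (w n i) eta; first by lra.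
    suff : w n i <= w n i ^+ 2 / eta by lra.
    by rewrite ler_pdivlMr// expr2 ler_wpM2l// ltW.
  rewrite mulr0 add0r -[leLHS]addr0 lerD// ler_wpM2l//.
  by apply: ltW; exact: HN.
rewrite !big_split/= -mulr_suml w1// mul1r -mulr_sumr -mulr_suml.
have sumI : \sum_(i < n) ind i <= N.+1%:R.
  rewrite /ind -natr_sum ler_nat.
  suff : (\sum_(i < n) (i < N) <= minn n N)%N.
    by move=> /leq_trans; apply; rewrite (leq_trans (geq_minr _ _)).
  elim: {+}n => [|k IHk]; first by rewrite big_ord0.
  rewrite big_ord_recr/=; move: IHk; set S := (\sum_(i < k) _)%N.
  by rewrite !leq_min; case: (ltnP k N) => kN /andP[? ?]; apply/andP; split; lia.
have A1 : eta * \sum_(i < n) ind i <= e / 4.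
  apply: (@le_trans _ _ (eta * N.+1%:R)); first by rewrite ler_wpM2l// ltW.
  by rewrite /eta divfK// pnatr_eq0.
have A2 : (\sum_(i < n) w n i ^+ 2) / eta <= e / 4 by rewrite ler_pdivrMr// mulrC.
lra.
Unshelve. all: by end_near. Qed.

End weights.


Section empirical.
Context {R : realType} {l : nat}.
Variables (w : nat -> nat -> R) (F : xfun R l).
Hypotheses (vw : vanishing_weights w) (dF : distfun l F) (ucF : unif_continuous F).

Lemma wecdf_obs_close {d} {Omega : measurableType d} (P : probability Omega R)
    (X : nat -> {RV P >-> borel 'rV[R]_l}) :
  independent_seq X -> {uniform, (fun i => df_of_rv (X i)) @ \oo --> F} ->
  forall e : R, 0 < e -> \forall n \near \oo, exists B : set Omega,
    [/\ measurable B, ((1 - e)%:E <= P B)%E &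
      forall o, B o -> sup_lt e F (wecdf w (obs X n o))].
Proof.
move=> indX XF e e0.
have e3 : 0 < e / 3 by rewrite divr_gt0.
have [de de0 GC] := glivenko_cantelli ucF e3.
have mX (i : nat) x : measurable [set o | le_pt (ext_pt (X i o)) x].
  exact: (measurable_funPTI (X i) (measurable_ext_pt_le x)).
have XF1 i x : `|F x - df_of_rv (X i) x| <= 1.
  have p1 : df_of_rv (X i) x <= 1.
    by rewrite -lee_fin fineK ?fin_num_measure// probability_le1.
  have p0 : 0 <= df_of_rv (X i) x by exact: fine_ge0.
  have := distfun_ge0 x dF; have := distfun_le1 x dF => F1 F0.
  by rewrite ler_norml; apply/andP; split; lra.
have [w0 w1 w2] := vw.
have mean := weighted_mean_close vw XF1 XF e3.
have sq := w2 _ de0.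
near=> n.
have [|||||B [mB PB BF]] := GC _ _ P n (fun i => w n i) (fun i o => obs X n o i).
- by move=> i; exact: w0.
- by move=> i x; exact: mX.
- move=> x i j ij.
  apply: (product_rule_pairwise (X := fun i o => X i o)
    (C := [set z | le_pt (ext_pt z) x]) _ _ _ ij) => //.
  - by move=> A mA; exact: independent_seq_product_rule.
  - by move=> k; exact: mX.
  - exact: measurable_ext_pt_le.
- by move=> x; move: x; near: n.
- by near: n.
exists B; split => //.
  by apply: le_trans PB; rewrite lee_fin; lra.
by move=> o /BF; rewrite mulrC divfK.
Unshelve. all: by end_near. Qed.

(** The bias is [F - H], bounded by [de] for every sample size, so the threshold for [n] is common
    to all [H]; only the good set [B] depends on [H]. *)
Lemma wecdf_iid_close (e : R) : 0 < e ->
  exists2 de : R, 0 < de & \forall n \near \oo,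
  forall H, distfun l H -> sup_lt de F H ->
  exists B : set (n.-tuple (borel (xspace R l))),
    [/\ measurable B, ((1 - e)%:E <= iid_prob (df_prob H) n B)%E &
      forall t, B t -> sup_lt e F (wecdf w (tnth t))].
Proof.
move=> e0; have e3 : 0 < e / 3 by rewrite divr_gt0.
exists (e / 3) => //.
have [de de0 GC] := glivenko_cantelli ucF e3.
have [w0 w1 w2] := vw.
have sq := w2 _ de0.
near=> n => H dH FH.
have n0 : (0 < n)%N by near: n; exact: nbhs_infty_gt.
have mO i x : measurable [set t : n.-tuple (borel (xspace R l)) | le_pt (tnth t i) x].
  rewrite -[X in measurable X]setTI.
  have mt : measurable_fun setT (fun t : n.-tuple (borel (xspace R l)) => tnth t i).
    exact: measurable_tnth.
  by have := mt measurableT _ (measurable_lower_orthant x).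
have [|||||B [mB PB BF]] := GC _ _ (iid_prob (df_prob H) n) n (fun i => w n i)
    (fun i (t : n.-tuple (borel (xspace R l))) => tnth t i).
- by move=> i; exact: w0.
- exact: mO.
- move=> x i j ij.
  apply: (product_rule_pairwise
    (X := fun i (t : n.-tuple (borel (xspace R l))) => tnth t i)
    (C := [set z | le_pt z x]) _ _ _ ij) => //.
  - move=> A mA; rewrite iid_prob_product//; congr EFin; apply: eq_bigr => k _.
    by rewrite -(@iid_prob_tnth _ _ _ (df_prob H) n (A k) k).
  - by move=> k; exact: mO.
  - exact: measurable_lower_orthant.
- move=> x.
  have pE (i : 'I_n) :
      fine (iid_prob (df_prob H) n [set t | le_pt (tnth t i) x]) = H x.
    have := @iid_prob_tnth _ _ _ (df_prob H) n _ i (measurable_lower_orthant x).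
    by rewrite (df_probP dH) => ->.
  under eq_bigr do rewrite pE.
  by rewrite -mulr_suml w1// mul1r ltW.
- by near: n.
exists B; split => //.
  by apply: le_trans PB; rewrite lee_fin; lra.
by move=> o /BF; rewrite mulrC divfK.
Unshelve. all: by end_near. Qed.

End empirical.

Lemma cvge_1 {R : realType} (f : nat -> \bar R) :
  (forall k, (f k <= 1)%E) ->
  (forall e : R, 0 < e -> \forall k \near \oo, ((1 - e)%:E <= f k)%E) ->
  f @ \oo --> 1%E.
Proof.
move=> f1 f_ge; apply/fine_cvgP; split.
  near=> k; have : ((1 - 1)%:E <= f k)%E by near: k; exact: f_ge.
  by have := f1 k; case: (f k).
apply/cvgrPdist_le => e e0; near=> k; rewrite /=.
have : ((1 - e)%:E <= f k)%E by near: k; exact: f_ge.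
have := f1 k; case: (f k) => //= r; rewrite !lee_fin => r1 er.
by rewrite ger0_norm ?subr_ge0//; lra.
Unshelve. all: by end_near. Qed.

Lemma inner_pr_le1 {d} {Omega : measurableType d} {R : realType}
  (P : probability Omega R) (A : set Omega) : (inner_pr P A <= 1)%E.
Proof. by apply: ge_ereal_sup => _ [B [mB _] <-]; exact: probability_le1. Qed.

Lemma inner_pr_ge {d} {Omega : measurableType d} {R : realType}
    (P : probability Omega R) (A B : set Omega) :
  measurable B -> B `<=` A -> (P B <= inner_pr P A)%E.
Proof. by move=> mB BA; apply: ereal_sup_ubound; exists B. Qed.

Lemma quantile_le {R : realType} (p t : R) (G : R -> \bar R) :
  (p%:E <= G t)%E -> (quantile p G <= t%:E)%E.
Proof. by move=> pG; apply: ereal_inf_lbound; exists t. Qed.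

(** * Consistency of the bootstrap tests *)

Section consistency.
Context {R : realType} {m s : nat}.
Context {d : measure_display} {Omega : measurableType d}.
Variables (P : probability Omega R).
Variables (X : nat -> {RV P >-> borel 'rV[R]_m}) (V : nat -> {RV P >-> borel 'rV[R]_s}).
Variables (K : xfun2 R m s) (a b : nat -> nat -> R) (j : xfun2 R m s -> xfun2 R m s).
Hypotheses (indX : independent_seq X) (indV : independent_seq V).
Hypotheses (dK : distfun2 m s K).
Hypotheses (ucK1 : unif_continuous K.1) (ucK2 : unif_continuous K.2).
Hypotheses (cvgX : {uniform, (fun i => df_of_rv (X i)) @ \oo --> K.1})
  (cvgV : {uniform, (fun i => df_of_rv (V i)) @ \oo --> K.2}).
Hypotheses (va : vanishing_weights a) (vb : vanishing_weights b).
Hypotheses (hj : forall L, distfun2 m s L -> distfun2 m s (j L))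
  (contj : {within (distfun2 m s : set (uxfun2 R m s)),
              continuous (j : uxfun2 R m s -> uxfun2 R m s)})
  (ucJ1 : unif_continuous (j K).1) (ucJ2 : unif_continuous (j K).2).
Variables (n r : nat -> nat).
Hypotheses (n_oo : n @ \oo --> \oo) (r_oo : r @ \oo --> \oo).

Lemma distfun2_emp p q (x : 'I_p -> xspace R m) (v : 'I_q -> xspace R s) :
  (0 < p)%N -> (0 < q)%N -> distfun2 m s (emp a b x v).
Proof.
case: va vb => a0 a1 _ [b0 b1 _] p0 q0; split; apply: distfun_wecdf => //.
- by move=> i; exact: a0.
- exact: a1.
- by move=> i; exact: b0.
- exact: b1.
Qed.

(* The threshold [t] separates the statistic of the actual sample, which exceeds
   it when the empirical distribution functions are close to [K], from the
   statistic of the bootstrap sample, which stays below it when they are close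
   to [j K]; so the critical value is at most [t]. *)
Lemma bootstrap_consistency
    (stat : forall p q, ('I_p -> xspace R m) -> ('I_q -> xspace R s) -> \bar R)
    (t : nat -> nat -> R) (alpha e1 e2 : R) :
  0 < alpha -> 0 < e1 -> 0 < e2 ->
  (forall p q (x : 'I_p -> xspace R m) (v : 'I_q -> xspace R s),
    (0 < p)%N -> (0 < q)%N -> sup_lt2 e1 K (emp a b x v) ->
    ((t p q)%:E <= stat p q x v)%E) ->
  (forall p q (x : 'I_p -> xspace R m) (v : 'I_q -> xspace R s),
    (0 < p)%N -> (0 < q)%N -> sup_lt2 e2 (j K) (emp a b x v) ->
    (stat p q x v <= (t p q)%:E)%E) ->
  (fun k => inner_pr P [set w |
    (crit_val (@stat (n k) (r k)) (1 - alpha)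
        (j (emp a b (obs X (n k) w) (obs V (r k) w))) <=
      stat _ _ (obs X (n k) w) (obs V (r k) w))%E]) @ \oo --> 1%E.
Proof.
move=> alpha0 e10 e20 stat_ge stat_le.
apply: cvge_1 => [k|e e0]; first exact: inner_pr_le1.
have [dJ1 dJ2] := hj dK; have [dK1 dK2] := dK.
(* Each bootstrap sample is good with probability at least [1 - e3], hence both are with probability
   at least [1 - 2 * e3 >= 1 - alpha], the order of the quantile. *)
pose e3 := Num.min e2 (alpha / 2).
have e30 : 0 < e3 by rewrite lt_min e20 divr_gt0.
have e3e2 : e3 <= e2 by rewrite /e3 ge_min lexx.
have e3a : e3 <= alpha / 2 by rewrite /e3 ge_min lexx orbT.
have [dem dem0 iidm] := wecdf_iid_close va ucJ1 e30.
have [des des0 iids] := wecdf_iid_close vb ucJ2 e30.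
have dems0 : 0 < Num.min dem des by rewrite lt_min dem0.
(* Continuity of [j] at [K] brings the random resampling distribution functions into the
   neighbourhood of [j K] on which [iidm] and [iids] hold. *)
have [e4 e40 jclose] := within_uniform_sup_lt2 contj dK dems0.
(* [e1] makes the statistic large, [e4] serves the continuity of [j], and [e / 2] is the share of
   each of the two samples in the probability lost. *)
pose e5 := Num.min (Num.min e1 e4) (e / 2).
have e50 : 0 < e5 by rewrite !lt_min e10 e40 divr_gt0.
have e51 : e5 <= e1 by rewrite /e5 !ge_min lexx.
have e54 : e5 <= e4 by rewrite /e5 !ge_min lexx orbT.
have e5e : e5 <= e / 2 by rewrite /e5 !ge_min lexx !orbT.
have obsX := wecdf_obs_close va dK1 ucK1 indX cvgX e50.
have obsV := wecdf_obs_close vb dK2 ucK2 indV cvgV e50.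
have n_ge N : \forall k \near \oo, (N <= n k)%N := n_oo (nbhs_infty_ge N).
have r_ge N : \forall k \near \oo, (N <= r k)%N := r_oo (nbhs_infty_ge N).
move: iidm iids obsX obsV => [N1 _ iidm] [N2 _ iids] [N3 _ obsX] [N4 _ obsV].
near=> k.
have nk0 : (0 < n k)%N by near: k; exact: n_ge.
have rk0 : (0 < r k)%N by near: k; exact: r_ge.
have nk1 : (N1 <= n k)%N by near: k; exact: n_ge.
have rk2 : (N2 <= r k)%N by near: k; exact: r_ge.
have nk3 : (N3 <= n k)%N by near: k; exact: n_ge.
have rk4 : (N4 <= r k)%N by near: k; exact: r_ge.
have [B1 [mB1 PB1 B1K]] := obsX _ nk3.
have [B2 [mB2 PB2 B2K]] := obsV _ rk4.
have mB : measurable (B1 `&` B2) by exact: measurableI.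
apply: (@le_trans _ _ (P (B1 `&` B2))).
  have mC : measurable (~` B2) by exact: measurableC.
  have : (P B1 <= P (B1 `&` B2) + P (~` B2))%E.
    apply: (@le_trans _ _ (P ((B1 `&` B2) `|` ~` B2))); last exact: measureU2.
    apply: le_measure; rewrite ?inE//; first exact: measurableU.
    by move=> w B1w; have [?|?] := pselect (B2 w); [left|right].
  rewrite probability_setC//; move: PB1 PB2.
  rewrite -(@fineK _ (P B1)) ?fin_num_measure// -(@fineK _ (P B2)) ?fin_num_measure//.
  rewrite -(@fineK _ (P (B1 `&` B2))) ?fin_num_measure//.
  by rewrite -EFinB -EFinD !lee_fin; lra.
apply: inner_pr_ge => // w [B1w B2w] /=.
have close5 : sup_lt2 e5 K (emp a b (obs X (n k) w) (obs V (r k) w)).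
  by split; [exact: B1K|exact: B2K].
have lt2W c c' (L L' : xfun2 R m s) : c <= c' -> sup_lt2 c L L' -> sup_lt2 c' L L'.
  by move=> cc' [L1 L2]; split=> x; exact: lt_le_trans cc'.
have dE := distfun2_emp (obs X (n k) w) (obs V (r k) w) nk0 rk0.
apply: le_trans (stat_ge _ _ _ _ nk0 rk0 (lt2W _ _ _ _ e51 close5)).
have [jE1 jE2] := jclose _ dE (lt2W _ _ _ _ e54 close5).
have [djE1 djE2] := hj dE.
have [|C1 [mC1 PC1 C1J]] := iidm _ nk1 _ djE1.
  by move=> x; apply: lt_le_trans (jE1 x) _; rewrite ge_min lexx.
have [|C2 [mC2 PC2 C2J]] := iids _ rk2 _ djE2.
  by move=> x; apply: lt_le_trans (jE2 x) _; rewrite ge_min lexx orbT.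
apply: quantile_le.
apply: (@le_trans _ _
    (sample_prob (j (emp a b (obs X (n k) w) (obs V (r k) w))) (C1 `*` C2))).
  rewrite /sample_prob product_measure1E//=; move: PC1 PC2.
  set p := iid_prob _ _ C1; set q := iid_prob _ _ C2.
  have p1 : (p <= 1)%E by exact: probability_le1.
  have q1 : (q <= 1)%E by exact: probability_le1.
  move: p1 q1; rewrite -(@fineK _ p) ?fin_num_measure// -(@fineK _ q) ?fin_num_measure//.
  rewrite -EFinM !lee_fin => p1 q1 pe qe.
  (* This product being nonnegative means [p * q >= p + q - 1]. *)
  by have : 0 <= (1 - fine p) * (1 - fine q); [rewrite mulr_ge0// subr_ge0|lra].
apply: inner_pr_ge; first exact: measurableX.
move=> [x v] [/= C1x C2v]; apply: stat_le => //.
by apply: lt2W e3e2 _; split; [exact: C1J|exact: C2J].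
Unshelve. all: by end_near. Qed.

End consistency.


(** * Thresholds separating the statistics of the actual and the bootstrap samples *)

Section statistics_separation.
Context {R : realType} {m s u : nat}.
Variables (T Q : xfun2 R m s -> xfun R u) (j : xfun2 R m s -> xfun2 R m s).
Variables (a b : nat -> nat -> R) (K : xfun2 R m s).
Hypotheses (hT : forall L, distfun2 m s L -> distfun u (T L))
  (hQ : forall L, distfun2 m s L -> distfun u (Q L))
  (hj : forall L, distfun2 m s L -> distfun2 m s (j L))
  (contT : {within (distfun2 m s : set (uxfun2 R m s)),
              continuous (T : uxfun2 R m s -> uxfun R u)})
  (contQ : {within (distfun2 m s : set (uxfun2 R m s)),
              continuous (Q : uxfun2 R m s -> uxfun R u)})
  (contj : {within (distfun2 m s : set (uxfun2 R m s)),
              continuous (j : uxfun2 R m s -> uxfun2 R m s)})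
  (TjQj : forall L, distfun2 m s L -> T (j L) = Q (j L))
  (dK : distfun2 m s K)
  (va : vanishing_weights a) (vb : vanishing_weights b).

Lemma within_uniform_sup_lt_pair (L : xfun2 R m s) (e : R) :
  distfun2 m s L -> 0 < e ->
  exists2 de : R, 0 < de & forall L', distfun2 m s L' -> sup_lt2 de L L' ->
    sup_lt e (T L) (T L') /\ sup_lt e (Q L) (Q L').
Proof.
move=> dL e0.
have [e1 e10 H1] := within_uniform_sup_lt contT dL e0.
have [e2 e20 H2] := within_uniform_sup_lt contQ dL e0.
exists (Num.min e1 e2); first by rewrite lt_min e10.
move=> L' dL' [LL1 LL2]; split; [apply: H1 => //|apply: H2 => //].
  by split=> x; [apply: lt_le_trans (LL1 x) _|apply: lt_le_trans (LL2 x) _];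
    rewrite ge_min lexx.
by split=> x; [apply: lt_le_trans (LL1 x) _|apply: lt_le_trans (LL2 x) _];
  rewrite ge_min lexx orbT.
Qed.

(** [T] and [Q] agree at [j K], so each of them may move by [e / 2]. *)
Lemma diff_near_fixpoint (e : R) : 0 < e ->
  exists2 de : R, 0 < de & forall L, distfun2 m s L -> sup_lt2 de (j K) L ->
    forall z, `|T L z - Q L z| <= e.
Proof.
move=> e0; have e20 : 0 < e / 2 by rewrite divr_gt0.
have [de de0 H] := within_uniform_sup_lt_pair (hj dK) e20.
exists de => // L dL JL z; have [HT HQ] := H L dL JL.
move: (HT z) (HQ z); rewrite (TjQj dK) !ltr_norml => /andP[? ?] /andP[? ?].
by rewrite ler_norml; apply/andP; split; lra.
Qed.

Let scale (p q : nat) : R := (p%:R * q%:R) `^ (4%:R^-1).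

Let scale_ge0 p q : 0 <= scale p q. Proof. exact: powR_ge0. Qed.

(** One point [z] with [D = |T K z - Q K z| > 0] suffices. Near [K] the difference at [z] is still
    at least [D - 2 * (D / 4) = D / 2], while near [j K] it is at most [D / 2] everywhere; [scale]
    multiplies both sides. *)
Lemma KS_separation : ~ (forall z, T K z - Q K z = 0) ->
  exists t : nat -> nat -> R, exists e1, exists e2, [/\ 0 < e1, 0 < e2,
    forall p q (x : 'I_p -> xspace R m) (v : 'I_q -> xspace R s),
      (0 < p)%N -> (0 < q)%N -> sup_lt2 e1 K (emp a b x v) ->
      ((t p q)%:E <= KS_stat T Q a b x v)%E &
    forall p q (x : 'I_p -> xspace R m) (v : 'I_q -> xspace R s),
      (0 < p)%N -> (0 < q)%N -> sup_lt2 e2 (j K) (emp a b x v) ->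
      (KS_stat T Q a b x v <= (t p q)%:E)%E].
Proof.
move=> /existsNP[z /eqP Dz].
set D := `|T K z - Q K z|; have D0 : 0 < D by rewrite normr_gt0.
have D40 : 0 < D / 4 by rewrite divr_gt0.
have [e1 e10 H1] := within_uniform_sup_lt_pair dK D40.
have [e2 e20 H2] := @diff_near_fixpoint (D / 2) ltac:(by rewrite divr_gt0).
exists (fun p q => scale p q * (D / 2)), e1, e2; split=> //.
  move=> p q x v p0 q0 Kxv.
  have [HT HQ] := H1 _ (distfun2_emp va vb x v p0 q0) Kxv.
  apply: (@le_trans _ _ (`|U_stat T Q a b x v z|)%:E); last first.
    by apply: ereal_sup_ubound; exists z.
  rewrite lee_fin /U_stat normrM -/(scale p q) (ger0_norm (scale_ge0 p q)).
  apply: ler_wpM2l => //.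
  set E := emp a b x v in HT HQ *.
  have DE : D <= `|T E z - Q E z| + `|T K z - T E z| + `|Q K z - Q E z|.
    rewrite /D (_ : T K z - Q K z = (T E z - Q E z) + (T K z - T E z) - (Q K z - Q E z)).
      by rewrite (le_trans (ler_normB _ _))// lerD2r ler_normD.
    by ring.
  by have := HT z; have := HQ z; lra.
move=> p q x v p0 q0 Jxv.
apply: ge_ereal_sup => _ [y _ <-].
rewrite lee_fin /U_stat normrM -/(scale p q) (ger0_norm (scale_ge0 p q)).
by apply: ler_wpM2l => //; apply: H2 => //; exact: distfun2_emp.
Qed.

Let measurable_diff L : distfun2 m s L ->
  measurable_fun setT ((fun z => (T L z - Q L z) ^+ 2) : borel (xspace R u) -> R).
Proof.
move=> dL; apply: measurable_funX; apply: measurable_funB; apply: measurable_distfun.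
  exact: hT.
exact: hQ.
Qed.

Let diff_le1 L z : distfun2 m s L -> `|T L z - Q L z| <= 1.
Proof.
move=> dL; have := distfun_ge0 z (hT dL); have := distfun_ge0 z (hQ dL).
have := distfun_le1 z (hT dL); have := distfun_le1 z (hQ dL).
by move=> ? ? ? ?; rewrite ler_norml; apply/andP; split; lra.
Qed.

Let integrable_diff L (mu : probability (borel (xspace R u)) R) : distfun2 m s L ->
  mu.-integrable setT (EFin \o (fun z => (T L z - Q L z) ^+ 2)).
Proof.
move=> dL; apply: (@bounded_integrable _ _ _ _ _ 1); first exact: measurable_diff.
by move=> z; rewrite normrX exprn_ile1// diff_le1.
Qed.

Lemma CvM_statE p q (x : 'I_p -> xspace R m) (v : 'I_q -> xspace R s) :
  distfun2 m s (emp a b x v) ->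
  CvM_stat T Q j a b x v = (scale p q ^+ 2 *
    \int[df_prob (T (j (emp a b x v)))]_z
      ((T (emp a b x v) z - Q (emp a b x v) z) ^+ 2))%:E.
Proof.
move=> dE; rewrite -RintegralZl//; last exact: integrable_diff.
rewrite /Rintegral fineK.
  by apply: eq_integral => z _; rewrite /U_stat exprMn.
have := integrableZl measurableT (scale p q ^+ 2)
  (integrable_diff (df_prob (T (j (emp a b x v)))) dE).
exact: integrable_fin_num.
Qed.

Lemma CvM_separation :
  ~ {ae df_prob (T (j K)), forall z, T K z - Q K z = 0} ->
  exists t : nat -> nat -> R, exists e1, exists e2, [/\ 0 < e1, 0 < e2,
    forall p q (x : 'I_p -> xspace R m) (v : 'I_q -> xspace R s),
      (0 < p)%N -> (0 < q)%N -> sup_lt2 e1 K (emp a b x v) ->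
      ((t p q)%:E <= CvM_stat T Q j a b x v)%E &
    forall p q (x : 'I_p -> xspace R m) (v : 'I_q -> xspace R s),
      (0 < p)%N -> (0 < q)%N -> sup_lt2 e2 (j K) (emp a b x v) ->
      (CvM_stat T Q j a b x v <= (t p q)%:E)%E].
Proof.
move=> Dae.
set mu := df_prob (T (j K)) in Dae.
pose I := \int[mu]_z ((T K z - Q K z) ^+ 2).
have I0 : 0 < I.
  rewrite lt_neqAle Rintegral_ge0 ?andbT; last by move=> z _; exact: sqr_ge0.
  (* A nonnegative function with zero integral vanishes almost everywhere, against [Dae]. *)
  apply/eqP => I0; apply: Dae.
  have : (\int[mu]_z `|((T K z - Q K z) ^+ 2)%:E| = 0)%E.
    under eq_integral do rewrite gee0_abs ?lee_fin ?sqr_ge0//.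
    have Ifin := integrable_fin_num measurableT (integrable_diff mu dK).
    have IE : (\int[mu]_z ((T K z - Q K z) ^+ 2)%:E = I%:E)%E.
      by rewrite /I /Rintegral fineK.
    by rewrite IE -I0.
  move=> /ae_eq_integral_abs H; have := H measurableT _.
  move=> /(_ _)[|N [mN N0 NE]].
    by apply/measurable_EFinP; exact: measurable_diff.
  exists N; split => // z /= Dz; apply: NE => /= /(_ Logic.I) [/eqP].
  by rewrite expf_eq0/= => /eqP.
(* Near [K] a quarter of [I] is lost to the change of measure,
   [4 * (2 ^+ u * (I / 16 / 2 ^+ u)) = I / 4], and a quarter to the change of integrand, which
   leaves [I / 2]. *)
have c0 : 0 < I / 16 by rewrite divr_gt0.
have c20 : 0 < I / 16 / 2 ^+ u by rewrite !divr_gt0 ?exprn_gt0.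
have [e1 e10 H1] := within_uniform_sup_lt_pair dK c0.
have [e2 e20 H2] := within_uniform_sup_lt contT (hj dK) c20.
have [e3 e30 H3] := within_uniform_sup_lt2 contj dK e20.
(* The cap at 1 gives [c ^+ 2 <= c <= I / 2] for the squared difference near [j K]. *)
pose c := Num.min 1 (I / 2).
have cc0 : 0 < c by rewrite lt_min ltr01 divr_gt0.
have [e4 e40 H4] := diff_near_fixpoint cc0.
exists (fun p q => scale p q ^+ 2 * (I / 2)), (Num.min e1 e3), e4; split=> //.
- by rewrite lt_min e10.
- move=> p q x v p0 q0 Kxv.
  have dE := distfun2_emp va vb x v p0 q0.
  rewrite CvM_statE// lee_fin; apply: ler_wpM2l; first exact: sqr_ge0.
  set E := emp a b x v in dE Kxv *.
  have [HT HQ] : sup_lt (I / 16) (T K) (T E) /\ sup_lt (I / 16) (Q K) (Q E).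
    apply: H1 => //; case: Kxv => K1 K2.
    by split=> y; [apply: lt_le_trans (K1 y) _|apply: lt_le_trans (K2 y) _];
      rewrite ge_min lexx.
  have HJ : sup_lt (I / 16 / 2 ^+ u) (T (j K)) (T (j E)).
    apply: H2; first exact: hj.
    apply: H3 => //; case: Kxv => K1 K2.
    by split=> y; [apply: lt_le_trans (K1 y) _|apply: lt_le_trans (K2 y) _];
      rewrite ge_min lexx orbT.
  have IJ := Rintegral_sqr_distfunB_close (hT dK) (hQ dK) (hT (hj dK)) (hT (hj dE))
    (fun z => ltW (HJ z)).
  rewrite (mulrC (2 ^+ u)) divfK ?expf_neq0// -/mu -/I in IJ.
  set nu := df_prob (T (j E)) in IJ *.
  have : \int[nu]_z ((T K z - Q K z) ^+ 2) - I / 4 <= \int[nu]_z ((T E z - Q E z) ^+ 2).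
    have -> : \int[nu]_z ((T K z - Q K z) ^+ 2) - I / 4 =
        \int[nu]_z ((T K z - Q K z) ^+ 2 - cst (I / 4) z).
      rewrite RintegralB//; first by rewrite Rintegral_cst//= probability_setT mulr1.
      - exact: integrable_diff.
      - exact: finite_measure_integrable_cst.
    apply: le_Rintegral => //.
    - have icst : nu.-integrable setT (EFin \o cst (I / 4)).
        exact: finite_measure_integrable_cst.
      by have := integrableB measurableT (integrable_diff nu dK) icst.
    - exact: integrable_diff.
    - move=> z _ /=; have := diff_le1 z dE; have := diff_le1 z dK.
      have := HT z; have := HQ z; rewrite !ltr_norml !ler_norml.
      move=> /andP[? ?] /andP[? ?] /andP[? ?] /andP[? ?].
      pose A := T K z - Q K z; pose B := T E z - Q E z; rewrite -/A -/B.
      have AB : `|A - B| <= I / 8 by rewrite /A /B ler_norml; apply/andP; split; lra.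
      (* The difference of squares factors; [A] and [B] are differences of distribution functions,
         so [|A + B| <= 2]. *)
      have : `|(A - B) * (A + B)| <= I / 8 * 2.
        by rewrite normrM ler_pM// /A /B ler_norml; apply/andP; split; lra.
      by rewrite ler_norml => /andP[_]; rewrite -subr_sqr; lra.
  by move: IJ; rewrite ler_norml => /andP[? ?] ?; lra.
- move=> p q x v p0 q0 Jxv.
  have dE := distfun2_emp va vb x v p0 q0.
  rewrite CvM_statE// lee_fin; apply: ler_wpM2l; first exact: sqr_ge0.
  set nu := df_prob _.
  apply: (@le_trans _ _ (\int[nu]_z (cst (I / 2) z))); last first.
    by rewrite Rintegral_cst//= probability_setT mulr1.
  apply: le_Rintegral => //.
  - exact: integrable_diff.
  - exact: finite_measure_integrable_cst.
  - move=> z _ /=; have := H4 _ dE Jxv z => Hc.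
    rewrite -real_normK ?num_real//; apply: (@le_trans _ _ (c ^+ 2)).
      by rewrite lerXn2r ?nnegrE// ltW.
    have c1 : c <= 1 by rewrite /c ge_min lexx.
    have cI : c <= I / 2 by rewrite /c ge_min lexx orbT.
    by apply: le_trans cI; rewrite expr2 ler_piMr// ltW.
Qed.

End statistics_separation.

Theorem corollary12 (R : realType) (m s u : nat)
  (hm : (0 < m)%N) (hs : (0 < s)%N) (hu : (0 < u)%N)
  (* the observations *)
  (d : measure_display) (Omega : measurableType d) (P : probability Omega R)
  (X : nat -> {RV P >-> borel 'rV[R]_m}) (V : nat -> {RV P >-> borel 'rV[R]_s})
  (indX : independent_seq X) (indV : independent_seq V)
  (indXV : independent_families X V)
  (F : xfun R m) (G : xfun R s) (hF : distfun m F) (hG : distfun s G)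
  (ucF : unif_continuous F) (ucG : unif_continuous G)
  (cvgF : {uniform, (fun i => df_of_rv (X i)) @ \oo --> F})
  (cvgG : {uniform, (fun i => df_of_rv (V i)) @ \oo --> G})
  (* the weights *)
  (a b : nat -> nat -> R) (kappa tau : R)
  (a_ge0 : forall n i, (i < n)%N -> 0 <= a n i)
  (a_sum1 : forall n, (0 < n)%N -> \sum_(i < n) a n i = 1)
  (a_max : (fun n => Num.sqrt n%:R * \big[Num.max/0]_(i < n) a n i) @ \oo --> 0)
  (kappa_ge1 : 1 <= kappa)
  (a_sum2 : (fun n => n%:R * \sum_(i < n) a n i ^+ 2) @ \oo --> kappa)
  (b_ge0 : forall r i, (i < r)%N -> 0 <= b r i)
  (b_sum1 : forall r, (0 < r)%N -> \sum_(i < r) b r i = 1)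
  (b_max : (fun r => Num.sqrt r%:R * \big[Num.max/0]_(i < r) b r i) @ \oo --> 0)
  (tau_ge1 : 1 <= tau)
  (b_sum2 : (fun r => r%:R * \sum_(i < r) b r i ^+ 2) @ \oo --> tau)
  (* the functionals *)
  (T Q : xfun2 R m s -> xfun R u) (j : xfun2 R m s -> xfun2 R m s)
  (hT : forall K, distfun2 m s K -> distfun u (T K))
  (hQ : forall K, distfun2 m s K -> distfun u (Q K))
  (hj : forall K, distfun2 m s K -> distfun2 m s (j K))
  (contT : {within (distfun2 m s : set (uxfun2 R m s)),
              continuous (T : uxfun2 R m s -> uxfun R u)})
  (contQ : {within (distfun2 m s : set (uxfun2 R m s)),
              continuous (Q : uxfun2 R m s -> uxfun R u)})
  (contj : {within (distfun2 m s : set (uxfun2 R m s)),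
              continuous (j : uxfun2 R m s -> uxfun2 R m s)})
  (TjQj : forall K, distfun2 m s K -> T (j K) = Q (j K))
  (jfix : forall K, distfun2 m s K -> T K = Q K -> j K = K)
  (stepT : forall n r w, (0 < n)%N -> (0 < r)%N ->
     countable_step (T (emp a b (obs X n w) (obs V r w))))
  (stepQ : forall n r w, (0 < n)%N -> (0 < r)%N ->
     countable_step (Q (emp a b (obs X n w) (obs V r w))))
  (stepTj : forall n r w, (0 < n)%N -> (0 < r)%N ->
     countable_step (T (j (emp a b (obs X n w) (obs V r w)))))
  (* differentiability at J = j (F, G) *)
  (ucJm : unif_continuous (j (F, G)).1) (ucJs : unif_continuous (j (F, G)).2)
  (dT dQ : xfun2 R m s -> xfun R u)
  (diffT : unif_hadamard_diff T (j (F, G)) dT)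
  (diffQ : unif_hadamard_diff Q (j (F, G)) dQ)
  (* the sample sizes *)
  (n r : nat -> nat) (eta : R)
  (n_oo : n @ \oo --> \oo) (r_oo : r @ \oo --> \oo)
  (eta_gt0 : 0 < eta) (nr_eta : (fun k => (n k)%:R / (r k)%:R) @ \oo --> eta)
  (* the limit process *)
  (d' : measure_display) (Omega' : measurableType d')
  (P' : probability Omega' R)
  (Mm : xspace R m -> {RV P' >-> R}) (Ms : xspace R s -> {RV P' >-> R})
  (gaussMm : centered_gaussian Mm (fun x y => kappa * eta *
     ((j (F, G)).1 (min_pt x y) - (j (F, G)).1 x * (j (F, G)).1 y)))
  (gaussMs : centered_gaussian Ms (fun v w => tau * eta *
     ((j (F, G)).2 (min_pt v w) - (j (F, G)).2 v * (j (F, G)).2 w)))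
  (indM : independent_families Mm Ms)
  (pathMm : {ae P', forall w, rho_unif_continuous (fun x => Mm x w)})
  (pathMs : {ae P', forall w, rho_unif_continuous (fun v => Ms v w)})
  (* the level *)
  (alpha : R) (alpha_gt0 : 0 < alpha) (alpha_lt1 : alpha < 1) :
  let J := j (F, G) in
  let U (w : Omega') : xfun R u := fun z =>
    dT (fun x => Mm x w, fun v => Ms v w) z -
    dQ (fun x => Mm x w, fun v => Ms v w) z in
  let strictly_increasing_df (Z : Omega' -> \bar R) :=
    forall t1 t2 : R, 0 <= t1 -> t1 < t2 ->
      (inner_pr P' [set w | Z w <= t1%:E] <
       inner_pr P' [set w | Z w <= t2%:E])%E in
  let KS n r w := KS_stat T Q a b (obs X n w) (obs V r w) in
  let CvM n r w := CvM_stat T Q j a b (obs X n w) (obs V r w) in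
  let J_hat n r w := j (emp a b (obs X n w) (obs V r w)) in
  let c_N n r w :=
    crit_val (@KS_stat _ _ _ _ T Q a b n r) (1 - alpha) (J_hat n r w) in
  let d_N n r w :=
    crit_val (@CvM_stat _ _ _ _ T Q j a b n r) (1 - alpha) (J_hat n r w) in
  (strictly_increasing_df (fun w => sup_abs (U w)) ->
   ~ (forall z, T (F, G) z - Q (F, G) z = 0) ->
   (fun k => inner_pr P [set w | (c_N (n k) (r k) w <= KS (n k) (r k) w)%E])
     @ \oo --> 1%E) /\
  (strictly_increasing_df (fun w => \int[df_prob (T J)]_z (U w z ^+ 2)%:E)%E ->
   ~ {ae df_prob (T J), forall z, T (F, G) z - Q (F, G) z = 0} ->
   (fun k => inner_pr P [set w | (d_N (n k) (r k) w <= CvM (n k) (r k) w)%E])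
     @ \oo --> 1%E).

Proof.
move=> J U strictly_increasing_df KS CvM J_hat c_N d_N.
have dK : distfun2 m s (F, G) by [].
have va : vanishing_weights a.
  by split=> //; exact: cvg_sum_sqr_vanishing a_sum2.
have vb : vanishing_weights b.
  by split=> //; exact: cvg_sum_sqr_vanishing b_sum2.
split=> _ D0.
  have [t [e1 [e2 [e10 e20 KS_ge KS_le]]]] :=
    KS_separation hj contT contQ TjQj dK va vb D0.
  exact: (@bootstrap_consistency _ _ _ _ _ P X V (F, G) a b j indX indV dK ucF ucG
    cvgF cvgG va vb hj contj ucJm ucJs n r n_oo r_oo
    (fun p q => @KS_stat _ _ _ _ T Q a b p q) t _ _ _ alpha_gt0 e10 e20 KS_ge KS_le).
have [t [e1 [e2 [e10 e20 CvM_ge CvM_le]]]] :=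
  CvM_separation hT hQ hj contT contQ contj TjQj dK va vb D0.
exact: (@bootstrap_consistency _ _ _ _ _ P X V (F, G) a b j indX indV dK ucF ucG
  cvgF cvgG va vb hj contj ucJm ucJs n r n_oo r_oo
  (fun p q => @CvM_stat _ _ _ _ T Q j a b p q) t _ _ _ alpha_gt0 e10 e20 CvM_ge CvM_le).
Qed.
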